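(* If $\dim(\mathrm{disjNP}\mid\mathrm{disjEXP})=1$, then $\dim(\mathrm{NP}\mid\mathrm{EXP})>0$.
   Context: $\mathrm{qp}$ is the class of functions computable in quasipolynomial time; $\mathrm{EXP}=\mathrm{TIME}(2^{\mathrm{poly}})$. Let $s_0,s_1,\dots$ be the length-lexicographic enumeration of $\{0,1\}^*$. For a finite alphabet $\Sigma$, a distribution $\beta$ on $\Sigma$ and $s\ge0$, a $\beta$-$s$-gale is $d:\Sigma^*\to[0,\infty)$ with $d(w)=\sum_{a\in\Sigma}d(wa)\beta(a)^s$ for all $w$; it succeeds on an infinite sequence $S\in\Sigma^\omega$ if $\limsup_n d(S\upharpoonright n)=\infty$. $d$ is qp-computable if there is $\hat d$ in qp with $|\hat d(w,r)-d(w)|\le2^{-r}$ (rational output, $r$ in unary). For a set $X$ of sequences, $\dim_{\mathrm{qp},\beta}(X)$ is the infimum of $s$ such that some qp-computable $\beta$-$s$-gale succeeds on every member of $X$. A language $A$ is identified with the sequence over $\{0,1\}$ whose $n$-th symbol is $1$ iff $s_n\in A$, and $\dim(X\mid\mathrm{EXP})=\dim_{\mathrm{qp},\beta_u}(X\cap\mathrm{EXP})$ with $\beta_u$ uniform on $\{0,1\}$ (ordinary $s$-gales). A disjoint pair is $(A,B)$ with $A\cap B=\emptyset$; it is coded as the sequence over $\{0,1,-1\}$ whose $n$-th symbol is $1$ if $s_n\in A$, $-1$ if $s_n\in B$, and $0$ otherwise. $\mathrm{disjNP}$ (resp. $\mathrm{disjEXP}$) is the set of disjoint pairs $(A,B)$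 with $A,B\in\mathrm{NP}$ (resp. $\mathrm{EXP}$). With $\gamma_0$ the distribution on $\{0,1,-1\}$ given by $\gamma_0(0)=1/4$, $\gamma_0(1)=\gamma_0(-1)=3/8$, define $\dim(X\mid\mathrm{disjEXP})=\dim_{\mathrm{qp},\gamma_0}(X\cap\mathrm{disjEXP})$. *)

(* Defs.v *)
From HB Require Import structures.
From mathcomp Require Import all_boot all_order all_algebra.
From mathcomp Require Import all_classical all_reals all_analysis.
From mathcomp Require Import lra.

Set Implicit Arguments.
Unset Strict Implicit.
Unset Printing Implicit Defensive.
Import Order.TTheory GRing.Theory Num.Theory.

Local Open Scope classical_set_scope.
Local Open Scope ring_scope.

Inductive move := MoveLeft | Stay | MoveRight.

Definition option_of_move (m : move) : option bool :=
  match m with MoveLeft => Some false | Stay => None | MoveRight => Some true end.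
Definition move_of_option (o : option bool) : move :=
  match o with Some false => MoveLeft | None => Stay | Some true => MoveRight end.
Lemma option_of_moveK : cancel option_of_move move_of_option.
Proof. by case. Qed.
HB.instance Definition _ := Finite.copy move (can_type option_of_moveK).

(* The tape alphabet is [option sym], with [None] the blank.  The transition
   relation is set-valued, so machines are nondeterministic in general. *)
Record machine := Machine {
  state : finType;
  sym : finType;
  tapes : nat;  (* number of tapes minus one *)
  start : state;
  accepting : pred state;
  delta : state -> {ffun 'I_tapes.+1 -> option sym} ->
          {set state * {ffun 'I_tapes.+1 -> option sym * move}} }.

(* [(l, r)] is the two-way infinite tape carrying [rev l ++ r], padded with
   blanks on both sides, with the head on the first cell of [r]. *)
Definition tape (G : Type) : Type := (seq (option G) * seq (option G))%type.

Definition blank_tape G : tape G := ([::], [::]).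
Definition scanned G (t : tape G) : option G := head None t.2.

Definition tape_act G (x : option G * move) (t : tape G) : tape G :=
  let: (a, m) := x in
  let: (l, r) := t in
  match m with
  | MoveLeft => (behead l, [:: head None l, a & behead r])
  | Stay => (l, a :: behead r)
  | MoveRight => (a :: l, behead r)
  end.

Fixpoint nonblank_prefix G (r : seq (option G)) : seq G :=
  if r is Some a :: r' then a :: nonblank_prefix r' else [::].
Definition tape_word G (t : tape G) : seq G := nonblank_prefix t.2.

Definition config (M : machine) : Type :=
  (state M * ('I_(tapes M).+1 -> tape (sym M)))%type.

Definition init (M : machine) (u : seq (sym M)) : config M :=
  (start M, fun i => if i == ord0 then ([::], map Some u) else blank_tape (sym M)).

Definition moves (M : machine) (c : config M) :=
  delta c.1 [ffun i => scanned (c.2 i)].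

Definition step (M : machine) (c c' : config M) : Prop :=
  exists2 x, x \in moves c & c' = (x.1, fun i => tape_act (x.2 i) (c.2 i)).

Fixpoint steps (M : machine) (n : nat) (c c' : config M) : Prop :=
  if n is n'.+1 then exists2 c1, step c c1 & steps n' c1 c' else c = c'.

Definition halted (M : machine) (c : config M) : bool := moves c == finset.set0.

Definition deterministic (M : machine) : Prop :=
  forall q a, (#|@delta M q a| <= 1)%N.

(* The bound holds on every computation path, so all of them halt. *)
Definition runs_within (M : machine) (u : seq (sym M)) (t : nat) : Prop :=
  forall n c, steps n (init u) c -> (n <= t)%N.

Definition accepts (M : machine) (u : seq (sym M)) : Prop :=
  exists n c, [/\ steps n (init u) c, halted c & accepting c.1].

(* The input is on the first tape and the output on the last one, starting
   under the head. *)
Definition outputs (M : machine) (u v : seq (sym M)) : Prop :=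
  exists n c, [/\ steps n (init u) c, halted c & tape_word (c.2 ord_max) = v].

Definition language := pred (seq bool).

Definition decides_in_time (M : machine) (inp : bool -> sym M)
    (t : nat -> nat) (A : language) : Prop :=
  forall w, runs_within (map inp w) (t (size w)) /\
            (A w <-> accepts (map inp w)).

Definition NP : set language := [set A | exists M inp k,
  injective inp /\ @decides_in_time M inp (fun n => n ^ k + k)%N A].

Definition EXP : set language := [set A | exists M inp k,
  [/\ deterministic M, injective inp
    & @decides_in_time M inp (fun n => 2 ^ (n ^ k + k))%N A]].

(* [D] is coded by [enc], and a word [v] denotes [dec v : E].  Running times
   2^(log(n)^O(1)) are bounded by 2^(floor(log2 n)^k + k) for some [k]. *)
Definition qp (D E : Type) (In Out : finType) (enc : D -> seq In)
    (dec : seq Out -> E) (f : D -> E) : Prop :=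
  exists (M : machine) (inp : In -> sym M) (outp : Out -> sym M) (k : nat),
    [/\ deterministic M, injective inp, injective outp &
      forall x, runs_within (map inp (enc x))
                            (2 ^ (trunc_log 2 (size (enc x)) ^ k + k))%N /\
        exists2 v, outputs (map inp (enc x)) (map outp v) & dec v = f x].

(* The pair [(w, r)], with [r] in unary, is coded as [w] followed by [r] copies
   of an additional symbol. *)
Definition enc_unary (S : finType) (x : seq S * nat) : seq (option S) :=
  map Some x.1 ++ nseq x.2 None.

Definition nat_of_bits (s : seq bool) : nat :=
  foldl (fun (n : nat) (b : bool) => n.*2 + b)%N 0%N s.

(* A rational is written as a sign bit ([true] for negative) and a numerator,
   followed by the separator [None] and a denominator, both in binary with the
   most significant bit first.  Fractions need not be reduced. *)
Definition rat_of_word (v : seq (option bool)) : rat :=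
  let i := index None v in
  let num := pmap id (take i v) in
  let den := pmap id (drop i v) in
  (-1) ^+ head false num * (nat_of_bits (behead num))%:R / (nat_of_bits den)%:R.

Record findist (R : realType) (S : finType) := Findist {
  pmf :> S -> R;
  pmf_ge0 : forall a, 0 <= pmf a;
  pmf_sum1 : \sum_a pmf a = 1 }.

Definition gale (R : realType) (S : finType) (beta : findist R S) (s : R)
    (d : seq S -> R) : Prop :=
  (forall w, 0 <= d w) /\
  (forall w, d w = \sum_a d (rcons w a) * (beta a `^ s)).

Definition succeeds (R : realType) (S : finType) (d : seq S -> R)
    (X : nat -> S) : Prop :=
  limn_esup (fun n => (d (mkseq X n))%:E) = +oo%E.

Definition qp_computable (R : realType) (S : finType) (d : seq S -> R) : Prop :=
  exists2 dhat : seq S * nat -> rat,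
    qp (@enc_unary S) rat_of_word dhat &
    forall w r, `|ratr (dhat (w, r)) - d w| <= 2^-1 ^+ r.

Definition dim_qp (R : realType) (S : finType) (beta : findist R S)
    (X : set (nat -> S)) : \bar R :=
  ereal_inf [set s%:E | s in [set s : R | 0 <= s /\
    exists d, [/\ gale beta s d, qp_computable d
                & forall x, X x -> succeeds d x]]].

(* Successor in the length-lexicographic order, on words written with their
   last symbol first. *)
Fixpoint lenlex_succ_rev (w : seq bool) : seq bool :=
  match w with
  | [::] => [:: false]
  | false :: w' => true :: w'
  | true :: w' => false :: lenlex_succ_rev w'
  end.

Definition lenlex (n : nat) : seq bool := rev (iter n lenlex_succ_rev [::]).

Definition char_seq (A : language) : nat -> bool := fun n => A (lenlex n).

Fact uniform_bool_ge0 (R : realType) (a : bool) : 0 <= 2^-1 :> R.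
Proof. by rewrite invr_ge0. Qed.
Fact uniform_bool_sum1 (R : realType) : \sum_(a : bool) 2^-1 = 1 :> R.
Proof. by rewrite big_bool /=; lra. Qed.
Definition uniform_bool (R : realType) : findist R bool :=
  Findist (@uniform_bool_ge0 R) (uniform_bool_sum1 R).

Definition dim_EXP (R : realType) (X : set language) : \bar R :=
  dim_qp (uniform_bool R) (char_seq @` (X `&` EXP)).

(* The alphabet {0, 1, -1}: [None] is 0, [Some true] is 1, [Some false] is -1. *)
Definition trit : finType := option bool.

Definition lang_pair : Type := (language * language)%type.

Definition disjoint_pair (P : lang_pair) : Prop :=
  forall w, ~~ (P.1 w && P.2 w).

Definition disj (C : set language) : set lang_pair :=
  [set P | [/\ disjoint_pair P, C P.1 & C P.2]].
Definition disjNP : set lang_pair := disj NP.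
Definition disjEXP : set lang_pair := disj EXP.

Definition pair_seq (P : lang_pair) : nat -> trit := fun n =>
  if P.1 (lenlex n) then Some true
  else if P.2 (lenlex n) then Some false
  else None.

Definition gamma0_pmf (R : realType) (a : trit) : R :=
  if a is Some _ then 3 / 8 else 1 / 4.
Fact gamma0_ge0 (R : realType) (a : trit) : 0 <= gamma0_pmf R a.
Proof. by case: a => [b|]; rewrite divr_ge0. Qed.
Fact gamma0_sum1 (R : realType) : \sum_a gamma0_pmf R a = 1.
Proof.
rewrite (bigD1 None) // (bigD1 (Some true)) // (bigD1 (Some false)) //=.
by rewrite big1 ?addr0; [lra | case=> [[]|]].
Qed.
Definition gamma0 (R : realType) : findist R trit :=
  Findist (@gamma0_ge0 R) (gamma0_sum1 R).

Definition dim_disjEXP (R : realType) (X : set lang_pair) : \bar R :=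
  dim_qp (gamma0 R) (pair_seq @` (X `&` disjEXP)).

(* Main.v *)
Require Import Defs.
From HB Require Import structures.
From mathcomp Require Import all_boot all_order all_algebra.
From mathcomp Require Import all_classical all_reals all_analysis.
From mathcomp Require Import zify lra.

(* Contrapositive.  Let [d] be a qp-computable [s]-gale, [s < 1/2], succeeding on
   all of NP within EXP.  Let [pi] map a coded pair [(A, B)] to the code of [A],
   that is, 1 to 1 and 0, -1 to 0.  Start from a large [D []] and put
     D(w 1) = d(pi(w) 1),  D(w -1) = 3/2 D(w) - d(pi(w) 1),  D(w 0) = 3/2 D(w).
   If [t] solves (3/8)^t + (1/4)^t = 2/3, then [D] is a [t]-gale for [gamma0], and
   [t < 1] because 3/8 + 1/4 < 2/3.  Since [3/2 >= 2^s], an induction gives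
   [D w >= d (pi w)], so [D] succeeds on every pair whose first component is in
   NP and EXP.  The numbers [s] and [t] need not be computable, but they have
   disappeared from the recursion for [D], which only involves rational
   coefficients: [D] is computed exactly from at most one approximate value of
   [d] per letter.  The Turing machine doing so keeps a fraction of natural
   numbers; as [d] and [D] are nonnegative, it may replace negative values by 0. *)

Set Implicit Arguments.
Unset Strict Implicit.
Unset Printing Implicit Defensive.
Import Order.TTheory GRing.Theory Num.Theory.
Import numFieldNormedType.Exports.

(** * Multistack machines *)

(** The factor 3/2 meets two demands. It is at least [2^s] for some positive [s], which lets [D]
    dominate [d], and it is below 8/5 = 1/(3/8 + 1/4), which puts the solution [t] below 1. The
    slack exists because the values at 1 and -1 add up to 3/2 D(w) and carry the same weight, so
    only one of the two weights 3/8 enters the equation for [t]. The obstacle is that computability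
    refers to concrete multitape Turing machines, so a program for [D] must be built. Stack machines
    are the programming language: they compose easily, are compiled once to Turing machines, and can
    simulate the machine given for [d]. Fractions are never reduced; their lengths stay small
    because each letter adds at most twice the length of one answer, plus a constant. Accuracy is
    cheap: an error at most doubles with each letter and gains one query error, so precision |w| + r
    is enough, and this number is the length of the coded input. *)

Section StackMachines.
Variables I G : finType.
Implicit Types (i j : I) (o : I -> option (G * option G)).

Definition store := I -> seq G.
Implicit Type s : store.

Definition top s i : option G := ohead (s i).

(* [None] pops, [Some (a, None)] replaces the top symbol by [a], and
   [Some (a, Some b)] moreover pushes [b] on top of [a].  On an empty stack
   there is nothing to replace, and [a] is pushed. *)
Definition op : Type := option (G * option G).

Definition op_seq (p : op) : seq G :=
  if p is Some (a, b) then (if b is Some b' then [:: b'; a] else [:: a])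
  else [::].

(** Every step removes the top of every stack, so leaving a stack alone means rewriting its top. *)
Definition op_keep (x : option G) : op := omap (fun a => (a, None)) x.
Definition op_push (b : G) (x : option G) : op :=
  Some (if x is Some a then (a, Some b) else (b, None)).

Definition apply_ops o s : store := fun i => op_seq (o i) ++ behead (s i).

Lemma op_keepK (l : seq G) : op_seq (op_keep (ohead l)) ++ behead l = l.
Proof. by case: l. Qed.

Lemma op_pushK b (l : seq G) : op_seq (op_push b (ohead l)) ++ behead l = b :: l.
Proof. by case: l. Qed.

(** A halting step still acts: the control [None] takes effect after the operations of that step.
    Sequencing therefore costs no extra step. *)
Record smach := SMach {
  ctl : finType;
  entry : ctl;
  act : ctl -> (I -> option G) -> option ctl * (I -> op) }.

Inductive runs (m : smach) : ctl m -> store -> nat -> store -> Prop :=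
| runs_last q s o : act q (top s) = (None, o) -> runs q s 1 (apply_ops o s)
| runs_more q q' s s' n o : act q (top s) = (Some q', o) ->
    runs q' (apply_ops o s) n s' -> runs q s n.+1 s'.

Definition does (m : smach) s (t : nat) s' : Prop :=
  exists2 n, n <= t & runs (entry m) s n s'.

Lemma does_le m s t t' s' : t <= t' -> does m s t s' -> does m s t' s'.
Proof. by move=> le_t [n le_n ?]; exists n => //; apply: leq_trans le_t. Qed.

(** A step adds up to two symbols to an empty stack and at most one to any other. This later bounds
    the length of an answer by the running time. *)
Lemma runs_size m (q : ctl m) s n s' i :
  runs q s n s' -> size (s' i) <= size (s i) + n.*2.
Proof.
have grow o s1 : size (apply_ops o s1 i) <= size (s1 i) + 2.
  rewrite size_cat size_behead.
  by case: (o i) => [[a [b|]]|] /=; lia.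
elim=> {q s n s'} [q s o _|q q' s s' n o _ _]; first by have := grow o s; lia.
by have := grow o s; lia.
Qed.

Definition upd s i (l : seq G) : store := fun j => if j == i then l else s j.

Definition pushm i (a : G) : smach :=
  @SMach unit tt (fun _ x => (None, fun j =>
    if j == i then op_push a (x j) else op_keep (x j))).

Lemma does_push i a s : does (pushm i a) s 1 (upd s i (a :: s i)).
Proof.
exists 1 => //.
suff -> : upd s i (a :: s i) = apply_ops (fun j =>
    if j == i then op_push a (top s j) else op_keep (top s j)) s.
  exact: (@runs_last (pushm i a)).
apply/funext => j; rewrite /upd /apply_ops.
by case: eqP => [->|_]; rewrite ?op_pushK ?op_keepK.
Qed.

Definition seqm (m1 m2 : smach) : smach :=
  @SMach (ctl m1 + ctl m2)%type (inl (entry m1)) (fun q x =>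
    match q with
    | inl q1 => let: (q', o) := act q1 x in
        (Some (if q' is Some q1' then inl q1' else inr (entry m2)), o)
    | inr q2 => let: (q', o) := act q2 x in (omap inr q', o)
    end).

Lemma does_seq m1 m2 s s1 s2 t1 t2 :
  does m1 s t1 s1 -> does m2 s1 t2 s2 -> does (seqm m1 m2) s (t1 + t2) s2.
Proof.
move=> [n1 le1 r1] [n2 le2 r2]; exists (n1 + n2); first exact: leq_add.
have {}r2 : runs (inr (entry m2) : ctl (seqm m1 m2)) s1 n2 s2.
  elim: r2 => [q x o E|q q' x x' n o E _ IH].
    by apply: runs_last; rewrite /= E.
  by apply: runs_more IH; rewrite /= E.
rewrite /=; elim: r1 r2 => [q x o E|q q' x x' n o E _ IH] r2.
  by apply: runs_more r2; rewrite /= E.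
by apply: runs_more (IH r2); rewrite /= E.
Qed.

Definition op_pop i (x : I -> option G) : I -> op :=
  fun j => if j == i then None else op_keep (x j).

Lemma apply_pop i s : apply_ops (op_pop i (top s)) s = upd s i (behead (s i)).
Proof.
apply/funext => j; rewrite /upd /apply_ops /op_pop.
by case: eqP => [->|_]; rewrite ?op_keepK.
Qed.

(** The branches may have different control types, so the control is a tagged sum over the possible
    tops, finite because the alphabet is. The state [None] inspects the stack and pops it. *)
Definition switchm i (f : option G -> smach) : smach :=
  @SMach (option {a : option G & ctl (f a)}) None (fun q x =>
    match q with
    | None => (Some (Some (Tagged (fun a => ctl (f a)) (entry (f (x i))))),
               op_pop i x)
    | Some (existT a q') => let: (q'', o) := act q' x in
        (omap (fun q => Some (Tagged (fun a => ctl (f a)) q)) q'', o)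
    end).

Lemma does_switch i f s s' t :
  does (f (ohead (s i))) (upd s i (behead (s i))) t s' ->
  does (switchm i f) s t.+1 s'.
Proof.
move=> [n le_n r]; exists n.+1 => //.
apply: runs_more => //=; rewrite apply_pop; move: r.
elim=> [q x o E|q q' x x' k o E _ IH].
  by apply: runs_last; rewrite /= E.
by apply: runs_more IH; rewrite /= E.
Qed.

(** The halting step of a body leads back to the inspecting state [None]; one turn thus costs one
    step more than its body. *)
Definition loopm i (f : G -> smach) : smach :=
  @SMach (option {a : G & ctl (f a)}) None (fun q x =>
    match q with
    | None => if x i is Some a
        then (Some (Some (Tagged (fun a => ctl (f a)) (entry (f a)))), op_pop i x)
        else (None, fun j => op_keep (x j))
    | Some (existT a q') => let: (q'', o) := act q' x in
        (Some (omap (fun q => Tagged (fun a => ctl (f a)) q) q''), o)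
    end).

Lemma apply_keep s : apply_ops (fun j => op_keep (top s j)) s = s.
Proof. by apply/funext => j; rewrite /apply_ops op_keepK. Qed.

Lemma does_loop0 i f s : s i = [::] -> does (loopm i f) s 1 s.
Proof.
move=> si; exists 1 => //.
rewrite -{2}(apply_keep s); apply: runs_last => /=.
by rewrite {1}/top si.
Qed.

Lemma does_loopS i f s s1 s2 a l t1 t2 : s i = a :: l ->
  does (f a) (upd s i l) t1 s1 -> does (loopm i f) s1 t2 s2 ->
  does (loopm i f) s (t1 + t2).+1 s2.
Proof.
move=> si [n1 le1 r1] [n2 le2 r2].
exists (n1 + n2).+1; first by rewrite ltnS leq_add.
apply: (@runs_more (loopm i f) None _ s); first by rewrite /= {1}/top si.
rewrite apply_pop si /=; elim: r1 r2 => [q x o E|q q' x x' n o E _ IH] r2.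
  by apply: runs_more r2; rewrite /= E.
by apply: runs_more (IH r2); rewrite /= E.
Qed.

(** The one primitive for bulk transfer: moving, copying to several stacks, filtering and erasing
    are choices of [f]. Contents arrive reversed. *)
Definition pourm i (f : G -> I -> option G) : smach :=
  @SMach unit tt (fun _ x =>
    if x i is Some a
    then (Some tt, fun j => if j == i then None
                            else if f a j is Some b then op_push b (x j)
                            else op_keep (x j))
    else (None, fun j => op_keep (x j))).

Lemma does_pour i f s : does (pourm i f) s (size (s i)).+1
  (fun j => if j == i then [::] else catrev (pmap (f^~ j) (s i)) (s j)).
Proof.
exists (size (s i)).+1 => //.
move E: (s i) => l; elim: l s E => [|a l IH] s si.
  have -> : (fun j => if j == i then [::] else catrev (pmap (f^~ j) [::]) (s j)) =
      apply_ops (fun j => op_keep (top s j)) s.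
    by rewrite apply_keep; apply/funext => j; case: eqP => // ->.
  by apply: runs_last; rewrite /= {1}/top si.
apply: (@runs_more (pourm i f) _ tt); first by rewrite /= {1}/top si.
set s1 := apply_ops _ _.
have s1E j : s1 j = if j == i then l else
    if f a j is Some b then b :: s j else s j.
  rewrite /s1 /apply_ops; case: eqP => [->|_]; first by rewrite si.
  by case: (f a j) => [b|]; rewrite ?op_pushK ?op_keepK.
have := IH s1; rewrite s1E eqxx => /(_ erefl).
congr runs; apply/funext => j; rewrite s1E; case: eqP => //= _.
by case: (f a j).
Qed.

End StackMachines.

(** * Compiling stack machines to Turing machines *)

Section ToMachine.
Variables (I G : finType) (i0 i1 : I) (m : smach I G).
Hypothesis i01 : i0 != i1.

(** Input must be on the first tape and output on the last; any other stack is placed by its rank.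
    The tapes at the ranks of [i0] and [i1] stay idle, so the inverse [stack_of] is partial. *)
Definition tape_of (i : I) : 'I_#|I|.+2 :=
  if i == i0 then ord0 else if i == i1 then ord_max
  else inord (enum_rank i).+1.

Lemma tape_of_inj : injective tape_of.
Proof.
have val_mid (i : I) : (inord (enum_rank i).+1 : 'I_#|I|.+2) = (enum_rank i).+1 :> nat.
  by rewrite inordK // !ltnS ltnW.
have mid (i : I) : 0 < (inord (enum_rank i).+1 : 'I_#|I|.+2) < #|I|.+1.
  by rewrite val_mid /= ltnS.
move=> i j; rewrite /tape_of.
case: (i =P i0) => Ei; case: (j =P i0) => Ej; first by rewrite Ei Ej.
- case: (j =P i1) => _ /(congr1 val) //=.
  by have /andP[] := mid j; case: (inord _) => -[].
- case: (i =P i1) => _ /(congr1 val) //=.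
  by have /andP[] := mid i; case: (inord _) => -[].
case: (i =P i1) => Ei'; case: (j =P i1) => Ej'; first by rewrite Ei' Ej'.
- move=> /(congr1 val) /= E; have /andP[_] := mid j.
  by rewrite -E ltnn.
- move=> /(congr1 val) /= E; have /andP[_] := mid i.
  by rewrite E ltnn.
move=> /(congr1 val) /=; rewrite !val_mid => -[E].
by apply/enum_rank_inj/val_inj.
Qed.

Definition stack_of (j : 'I_#|I|.+2) : option I := [pick i | tape_of i == j].

Lemma stack_ofK i : stack_of (tape_of i) = Some i.
Proof.
rewrite /stack_of; case: pickP => [j /eqP/tape_of_inj -> //|/(_ i)].
by rewrite eqxx.
Qed.

Definition op_act (p : op G) : option G * move :=
  match p with
  | None => (None, MoveRight)
  | Some (a, None) => (Some a, Stay)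
  | Some (a, Some _) => (Some a, MoveLeft)
  end.

Definition op_second (p : op G) : option G := if p is Some (_, b) then b else None.

Definition tm_state : finType :=
  (option (ctl m) + (option (ctl m) * {ffun I -> option G}))%type.

(* A step of the stack machine takes two steps of the Turing machine: a push
   first makes room above the top of the stack and then writes there. *)
Definition tm_delta (q : tm_state) (x : {ffun 'I_#|I|.+2 -> option G}) :
    {set tm_state * {ffun 'I_#|I|.+2 -> option G * move}} :=
  match q with
  | inl None => finset.set0
  | inl (Some q) => let: (q', o) := act q (fun i => x (tape_of i)) in
      finset.set1 (inr (q', [ffun i => op_second (o i)]),
             [ffun j => if stack_of j is Some i then op_act (o i)
                        else (None, Stay)])
  | inr (q', b) =>
      finset.set1 (inl q', [ffun j =>
        if stack_of j is Some i then (if b i is Some c then Some c else x j, Stay)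
        else (None, Stay)])
  end.

Definition tm_of : machine :=
  @Machine tm_state G #|I|.+1 (inl (Some (entry m))) predT tm_delta.

Lemma tm_of_deterministic : deterministic tm_of.
Proof.
move=> [[q|]|[q b]] x /=; rewrite ?cards0 ?cards1 //.
by case: act => q' o; rewrite cards1.
Qed.

(** The head is on the top of the stack. Pops erase before moving right, so only blanks lie to the
    left; the trailing blanks are explicit cells left where an empty stack was rewritten. *)
Definition holds_stack (t : tape G) (l : seq G) : Prop :=
  (forall x, x \in t.1 -> x = None) /\ exists k, t.2 = map Some l ++ nseq k None.

Lemma holds_scanned t l : holds_stack t l -> scanned t = ohead l.
Proof. by case: t => tl tr [_ [k /= ->]]; case: l => //; case: k. Qed.

Lemma holds_op t l p : holds_stack t l ->
  holds_stack (let t1 := tape_act (op_act p) t in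
    tape_act (if op_second p is Some c then Some c else scanned t1, Stay) t1)
    (op_seq p ++ behead l).
Proof.
case: t => tl tr [/= tl_blank [k ->]].
have [k' next] : exists k', behead (map Some l ++ nseq k None) =
    map Some (behead l) ++ nseq k' (@None G).
  by case: l => [|a l]; [exists k.-1; case: k | exists k].
case: p => [[a [b|]]|] /=; split=> /=.
- by move=> x x_tl; apply: tl_blank; apply: mem_behead.
- by exists k'; rewrite next.
- exact: tl_blank.
- by exists k'; rewrite next.
- by move=> x; rewrite inE => /predU1P[-> //|/tl_blank].
(* On an empty stack the second step writes back the scanned blank, which becomes an explicit cell
   even if the list had ended. *)
- rewrite next; case: (behead l) => [|b l']; last by exists k'.
  by case: k' {next} => [|k1]; [exists 1 | exists k1.+1].
Qed.

Definition holds_config (c : config tm_of) (q : option (ctl m)) (s : store I G) :=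
  c.1 = inl q /\ forall i, holds_stack (c.2 (tape_of i)) (s i).

Lemma tm_step c q s q' o : holds_config c (Some q) s ->
  act q (top s) = (q', o) ->
  exists2 c', steps 2 c c' & holds_config c' q' (apply_ops o s).
Proof.
case: c => cq ct [/= -> hold] E.
pose ct1 := fun j => tape_act
  ([ffun j => if stack_of j is Some i then op_act (o i) else (None, Stay)] j) (ct j).
pose ct2 := fun j => tape_act
  ([ffun j => if stack_of j is Some i
      then (if op_second (o i) is Some c then Some c else scanned (ct1 j), Stay)
      else (None, Stay)] j) (ct1 j).
have topE : (fun i => [ffun j => scanned (ct j)] (tape_of i)) = top s.
  by apply/funext => i; rewrite ffunE (holds_scanned (hold i)).
exists (inl q', ct2).
  exists (inr (q', [ffun i => op_second (o i)]), ct1).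
    exists (inr (q', [ffun i => op_second (o i)]),
      [ffun j => if stack_of j is Some i then op_act (o i) else (None, Stay)]) => //.
    by rewrite /moves /= topE E inE.
  eexists; last by [].
  exists (inl q', [ffun j => if stack_of j is Some i
      then (if op_second (o i) is Some c then Some c else scanned (ct1 j), Stay)
      else (None, Stay)]) => //.
  rewrite /moves /= inE; apply/eqP; congr pair; apply/ffunP => j.
  by rewrite !ffunE; case: stack_of => // i; rewrite ffunE.
split=> // i /=; rewrite /ct2 ffunE stack_ofK /apply_ops.
have := @holds_op _ _ (o i) (hold i).
by rewrite /ct1 ffunE stack_ofK.
Qed.

Lemma steps_cat (M : machine) n1 n2 (c c1 c2 : config M) :
  steps n1 c c1 -> steps n2 c1 c2 -> steps (n1 + n2) c c2.
Proof.
elim: n1 c => [|n IH] c /=; first by move=> ->.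
by move=> [c' st sts] sts2; exists c' => //; apply: IH sts2.
Qed.

Lemma tm_runs c q s n s' : holds_config c (Some q) s -> runs q s n s' ->
  exists2 c', steps n.*2 c c' & holds_config c' None s'.
Proof.
move=> hold r; elim: r c hold => {q s n s'} [q s o E|q q' s s' n o E _ IH] c hold.
  by have [c' ? ?] := tm_step hold E; exists c'.
have [c1 st1 hold1] := tm_step hold E.
have [c' st' hold'] := IH _ hold1.
by exists c' => //; rewrite doubleS -addn2 addnC; apply: steps_cat st1 st'.
Qed.

(** By determinism every computation is a prefix of the halting one. *)
Lemma deterministic_runs_within (M : machine) u n (c : config M) :
  deterministic M -> steps n (init u) c -> halted c -> runs_within u n.
Proof.
move=> det; rewrite /runs_within; move: (init u) => c0.
elim: n c0 => [|n IH] c0 /= => [->|[c1 st sts]] hc [|k] c' //=.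
  by move=> [c1 [x]]; rewrite (eqP hc) inE.
move=> [c2 st2 sts2]; rewrite ltnS; apply: (IH c1 sts hc _ c').
suff -> : c1 = c2 by [].
case: st st2 => [x xin ->] [y yin ->].
have /card_le1_eqP := det c0.1 [ffun i => scanned (c0.2 i)].
by move=> /(_ x y xin yin) ->.
Qed.

Lemma tm_of_computes (u v : seq G) n s' :
  runs (entry m) (fun i => if i == i0 then u else [::]) n s' -> s' i1 = v ->
  runs_within (u : seq (sym tm_of)) n.*2 /\ outputs (u : seq (sym tm_of)) v.
Proof.
move=> r s'v.
have hold : holds_config (init (u : seq (sym tm_of))) (Some (entry m))
    (fun i => if i == i0 then u else [::]).
  split=> // i /=.
  have -> : ord0 = tape_of i0 by rewrite /tape_of eqxx.
  rewrite (inj_eq tape_of_inj); case: eqP => _.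
    by split=> //; exists 0; rewrite cats0.
  by split=> //; exists 0.
have [[q t] st [/= qE hold']] := tm_runs hold r.
have hc : halted (q, t : _ -> tape G) by rewrite qE; apply/eqP.
split; first exact: deterministic_runs_within tm_of_deterministic st hc.
exists n.*2, (q, t); split=> //=.
have -> : ord_max = tape_of i1 by rewrite /tape_of eq_sym (negPf i01) eqxx.
have [_ [k]] := hold' i1; rewrite /tape_word s'v => ->.
by elim: v {s'v hold' st r qE hc} => [|a v IH] /=; [case: k | rewrite IH].
Qed.

End ToMachine.

(** * Simulation of a machine on stacks *)

Section Simulation.
Variables (M : machine) (J W : finType).
Hypothesis detM : deterministic M.

Definition stack_name : finType := (J + 'I_(tapes M).+1 * bool)%type.
(** [inl None] is an explicit blank of [M], as a blank cell must be told apart from the bottom of a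
    stack. [W] is the alphabet of the surrounding program. *)
Definition stack_sym : finType := (option (sym M) + W)%type.
Definition left_of (j : 'I_(tapes M).+1) : stack_name := inr (j, false).
Definition right_of (j : 'I_(tapes M).+1) : stack_name := inr (j, true).

Definition tape_stacks (e : J -> seq stack_sym) (t : 'I_(tapes M).+1 -> tape (sym M)) :
    store stack_name stack_sym :=
  fun i => match i with
  | inl j => e j
  | inr (j, b) => map inl (if b then (t j).2 else (t j).1)
  end.

Definition sim_scan (x : stack_name -> option stack_sym) j : option (sym M) :=
  if x (right_of j) is Some (inl c) then c else None.

(** The two lists of a tape are used as stacks as they stand. Moving left carries the top of the
    left stack over to the right one, or an explicit blank if the left one is empty. *)
Definition sim_ops (x : stack_name -> option stack_sym)
    (a : {ffun 'I_(tapes M).+1 -> option (sym M) * move}) (i : stack_name) : op stack_sym :=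
  match i with
  | inl _ => op_keep (x i)
  | inr (j, onright) =>
    let c : stack_sym := inl (a j).1 in
    match (a j).2, onright with
    | MoveLeft, false => None
    | MoveLeft, true =>
        Some (c, Some (if x (left_of j) is Some g then g else inl None))
    | Stay, false => op_keep (x i)
    | Stay, true => Some (c, None)
    | MoveRight, false => op_push c (x i)
    | MoveRight, true => None
    end
  end.

Definition simm : smach stack_name stack_sym :=
  @SMach stack_name stack_sym (state M) (start M) (fun q x =>
    if [pick y in delta q [ffun j => sim_scan x j]] is Some y
    then (Some y.1, sim_ops x y.2) else (None, fun i => op_keep (x i))).

Lemma apply_sim e (t : 'I_(tapes M).+1 -> tape (sym M))
    (a : {ffun 'I_(tapes M).+1 -> option (sym M) * move}) :
  apply_ops (sim_ops (top (tape_stacks e t)) a) (tape_stacks e t) =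
  tape_stacks e (fun j => tape_act (a j) (t j)).
Proof.
apply/funext => -[j|[j b]]; rewrite /apply_ops /= ?op_keepK //.
rewrite /sim_ops /top /=; case: (t j) => l r /=.
case: (a j) => x [] /=; case: b => /=.
- by case: l => [|y l] /=; case: r.
- by case: l.
- by case: r.
- by rewrite op_keepK.
- by case: r.
- by rewrite op_pushK.
Qed.

(** Determinism forces [pick] to find the transition actually taken; the additional step is the one
    that detects halting. *)
Lemma runs_sim e n (c c' : config M) : steps n c c' -> halted c' ->
  runs (c.1 : ctl simm) (tape_stacks e c.2) n.+1 (tape_stacks e c'.2).
Proof.
have scanE (c0 : config M) : [ffun j => sim_scan (top (tape_stacks e c0.2)) j] =
    [ffun j => scanned (c0.2 j)].
  apply/ffunP => j; rewrite !ffunE /sim_scan /top /scanned /=.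
  by case: (c0.2 j).2.
elim: n c => [|n IH] c /= => [->|[c1 [y y_in ->] sts]] hc.
  rewrite -{2}(apply_keep (tape_stacks e c'.2)); apply: runs_last => /=.
  rewrite scanE; case: pickP => [z|_] //.
  by have := eqP hc; rewrite /moves => ->; rewrite inE.
have := IH _ sts hc => /=; rewrite -apply_sim; apply: (@runs_more _ _ simm).
rewrite /= scanE; case: pickP => [z z_in|/(_ y)].
  by have /card_le1_eqP/(_ y z y_in z_in) <- := detM c.1 [ffun j => scanned (c.2 j)].
by move: y_in; rewrite /moves => ->.
Qed.

(** Restores blank tapes, so that the simulated machine can be queried again for the next letter.
    All tapes are popped in parallel. *)
Definition scrubm : smach stack_name stack_sym :=
  @SMach stack_name stack_sym unit tt (fun _ x =>
    if [forall k : 'I_(tapes M).+1 * bool, ~~ (x (inr k) : bool)]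
    then (None, fun i => op_keep (x i))
    else (Some tt, fun i => if i is inl _ then op_keep (x i) else None)).

Lemma does_scrub (s : store stack_name stack_sym) n :
  (forall k, size (s (inr k)) <= n) ->
  does scrubm s n.+1 (fun i => if i is inl _ then s i else [::]).
Proof.
elim: n s => [|n IH] s szn.
  exists 1 => //.
  have -> : (fun i => if i is inl _ then s i else [::]) =
      apply_ops (fun i => op_keep (top s i)) s.
    rewrite apply_keep; apply/funext => -[//|k].
    by have := szn k; case: (s (inr k)).
  apply: runs_last => /=; case: ifP => // /negbT/forallPn[k].
  by rewrite /top; have := szn k; case: (s (inr k)).
have [/forallP all0|nall] := boolP [forall k : 'I_(tapes M).+1 * bool, ~~ (top s (inr k) : bool)].
  exists 1 => //.
  have -> : (fun i => if i is inl _ then s i else [::]) =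
      apply_ops (fun i => op_keep (top s i)) s.
    rewrite apply_keep; apply/funext => -[//|k].
    by have := all0 k; rewrite /top; case: (s (inr k)).
  by apply: runs_last => /=; case: ifP => // /negbT/forallPn[k]; rewrite all0.
pose s1 := apply_ops (fun i => if i is inl _ then op_keep (top s i) else None) s.
have s1l j : s1 (inl j) = s (inl j) by rewrite /s1 /apply_ops /= op_keepK.
have [k|k le_k run] := IH s1.
  by rewrite /s1 /apply_ops /= size_behead -subn1 leq_subLR add1n.
exists k.+1; rewrite ?ltnS //.
apply: (@runs_more _ _ scrubm _ tt); first by rewrite /= (negPf nall).
move: run; congr runs; apply/funext => -[j|//]; exact: s1l.
Qed.

End Simulation.

(** * Binary arithmetic on stacks *)

(* [lia] would split on every equality test between stack names. *)
Ltac nlia :=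
  repeat match goal with
  | H : (_ == _) = false |- _ => clear H
  | H : is_true (_ != _) |- _ => clear H
  | H : is_true (uniq _) |- _ => clear H
  | H : runs _ _ _ _ |- _ => clear H
  | H : does _ _ _ _ |- _ => clear H
  end; lia.

Section Arithmetic.
Variables (I G : finType) (bit : bool -> G) (isone : G -> bool).
Hypothesis isone_bit : forall b, isone (bit b) = b.
Implicit Types (l : seq G) (s : store I G).

Lemma upd_same s i l : upd s i l i = l.
Proof. by rewrite /upd eqxx. Qed.

Lemma upd_diff s i j l : j != i -> upd s i l j = s j.
Proof. by rewrite /upd => /negPf->. Qed.

Definition move_to i j : smach I G :=
  pourm i (fun a k => if k == j then Some a else None).

Lemma does_move i j s : i != j ->
  does (move_to i j) s (size (s i)).+1 (upd (upd s i [::]) j (catrev (s i) (s j))).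
Proof.
move=> nij; have := does_pour i (fun a k => if k == j then Some a else None) s.
congr does; apply/funext => k; rewrite /upd.
case: (eqVneq k i) => [->|_]; first by rewrite (negPf nij).
case: (eqVneq k j) => [->|_]; last by elim: (s i).
by congr catrev; elim: (s i) => //= a l ->.
Qed.

Definition clear i : smach I G := pourm i (fun _ _ => None).

Lemma does_clear i s : does (clear i) s (size (s i)).+1 (upd s i [::]).
Proof.
have := does_pour i (fun _ _ => None) s.
by congr does; apply/funext => k; rewrite /upd; case: eqP => // _; elim: (s i).
Qed.

(* Numbers are written with the least significant bit on top of the stack. *)
Definition nat_of_stack l : nat := foldr (fun g n => isone g + n.*2) 0 l.

Definition top_bit (a : option G) : bool := if a is Some g then isone g else false.

Lemma nat_of_stack_step l : nat_of_stack l = top_bit (ohead l) + (nat_of_stack (behead l)).*2.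
Proof. by case: l. Qed.

Lemma nat_of_stack_rcons l g : nat_of_stack (rcons l g) = nat_of_stack l + isone g * 2 ^ size l.
Proof.
elim: l => [|h l IH] /=; first by rewrite muln1 addn0.
by rewrite IH doubleD -!muln2 -mulnA -expnSr addnA.
Qed.

Section Registers.
(** Scratch stacks: [T] keeps an operand to be restored, [S] collects result digits, [X] holds the
    digits of a multiplier and [Z] the product. *)
Variables T S X Z : I.
Hypothesis uniq_regs : uniq [:: T; S; X; Z].

Let nTS : (T == S) = false. Proof. by move: uniq_regs; rewrite /= !inE; case: eqP. Qed.
Let nST : (S == T) = false. Proof. by rewrite eq_sym. Qed.
Let nTX : (T == X) = false.
Proof. by move: uniq_regs; rewrite /= !inE; case: (T == X); rewrite ?orbT. Qed.
Let nTZ : (T == Z) = false.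
Proof. by move: uniq_regs; rewrite /= !inE; case: (T == Z); rewrite ?orbT. Qed.
Let nZT : (Z == T) = false. Proof. by rewrite eq_sym. Qed.
Let nSX : (S == X) = false.
Proof. by move: uniq_regs; rewrite /= !inE; case: (S == X); rewrite ?andbF. Qed.
Let nSZ : (S == Z) = false.
Proof. by move: uniq_regs; rewrite /= !inE; case: (S == Z); rewrite ?orbT ?andbF. Qed.
Let nZS : (Z == S) = false. Proof. by rewrite eq_sym. Qed.
Let nXZ : (X == Z) = false.
Proof. by move: uniq_regs; rewrite /= !inE; case: (X == Z); rewrite ?andbF. Qed.
Let nZX : (Z == X) = false. Proof. by rewrite eq_sym. Qed.

Section Carry.
Variable carry : bool -> bool -> bool -> bool.

(** In addition and in subtraction a digit is the exclusive or of both operand digits and the carry.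
    Only the carry rule differs, so both share this pass. *)
Fixpoint digits n (c : bool) (ys zs : seq G) : seq bool * bool :=
  if n is n'.+1 then
    let a := top_bit (ohead ys) in let b := top_bit (ohead zs) in
    let: (bs, c') := digits n' (carry a b c) (behead ys) (behead zs) in
    (a (+) b (+) c :: bs, c')
  else ([::], c).

(** The operands are consumed, hence the copy of [y] on [T]. The final carry ends on top of [S],
    where it can be tested. *)
Definition digitm (y z : I) : smach I G :=
  @SMach I G bool false (fun c x =>
    if ~~ (x y) && ~~ (x z) then
      (None, fun j => if j == S then op_push (bit c) (x j) else op_keep (x j))
    else
      (Some (carry (top_bit (x y)) (top_bit (x z)) c),
       fun j => if (j == y) || (j == z) then None
         else if j == S then op_push (bit (top_bit (x y) (+) top_bit (x z) (+) c)) (x j)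
         else if j == T then (if x y is Some g then op_push g (x j) else op_keep (x j))
         else op_keep (x j))).

Lemma runs_digit y z c s n : maxn (size (s y)) (size (s z)) = n ->
  y != z -> y \notin [:: T; S] -> z \notin [:: T; S] ->
  runs (c : ctl (digitm y z)) s n.+1
    (upd (upd (upd (upd s y [::]) z [::]) T (catrev (s y) (s T))) S
      (bit (digits n c (s y) (s z)).2 ::
       catrev (map bit (digits n c (s y) (s z)).1) (s S))).
Proof.
move=> + nyz; rewrite !inE !negb_or => + /andP[nyT nyS] /andP[nzT nzS].
elim: n c s => [|k IH] c s En.
  have {En} [sy sz] : s y = [::] /\ s z = [::].
    by move: En; case: (s y); case: (s z) => //= *; nlia.
  set s' := upd _ _ _.
  have -> : s' = apply_ops (fun j => if j == S then op_push (bit c) (top s j)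
                                     else op_keep (top s j)) s.
    apply/funext => j; rewrite /s' /apply_ops /upd sy sz /=.
    case: eqP => [->|_]; first by rewrite op_pushK.
    rewrite op_keepK; case: eqP => [-> //|_].
    by case: eqP => [->|_] //; case: eqP => [->|_].
  by apply: runs_last; rewrite /= /top sy sz.
set a := top_bit (ohead (s y)); set b := top_bit (ohead (s z)).
have neither : ~~ (top s y) && ~~ (top s z) = false.
  by move: En; rewrite /top; case: (s y); case: (s z).
apply: (@runs_more _ _ (digitm y z) c (carry a b c)) => /=.
  by rewrite neither.
set s1 := apply_ops _ s.
have s1E j : s1 j = if (j == y) || (j == z) then behead (s j) else
    if j == S then bit (a (+) b (+) c) :: s j else
    if j == T then (if ohead (s y) is Some g then g :: s j else s j) else s j.
  rewrite /s1 /apply_ops; case: ifP => // _; case: eqP => _; first by rewrite op_pushK.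
  case: eqP => _; last by rewrite op_keepK.
  by rewrite /top; case: (s y) => [|g l] /=; rewrite ?op_keepK ?op_pushK.
have s1y : s1 y = behead (s y) by rewrite s1E eqxx.
have s1z : s1 z = behead (s z) by rewrite s1E eqxx orbT.
have E1 : maxn (size (s1 y)) (size (s1 z)) = k.
  by rewrite s1y s1z !size_behead; nlia.
have := IH (carry a b c) _ E1; congr runs.
apply/funext => j; rewrite /upd s1y s1z !s1E [T == y]eq_sym [T == z]eq_sym.
rewrite [S == y]eq_sym [S == z]eq_sym (negPf nyT) (negPf nyS) (negPf nzT) (negPf nzS).
rewrite eqxx nTS eqxx /= -/a -/b.
case: (digits k _ _ _) => bs c' /=.
case: eqP => // _; case: eqP => [_|_]; first by case: (s y).
by case: (j == z); case: (j == y).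
Qed.

Lemma size_digits n c ys zs : size (digits n c ys zs).1 = n.
Proof.
elim: n c ys zs => //= n IH c ys zs.
by case E: (digits n _ _ _) => [bs c'] /=; rewrite -[bs]/((bs, c').1) -E IH.
Qed.

End Carry.

(** Majority for addition; for subtraction the borrow of b - a - c, with the subtrahend as first
    argument. *)
Definition carry_add (a b c : bool) := (a && b) || (a && c) || (b && c).
Definition carry_sub (a b c : bool) := (~~ b && (a || c)) || (a && c).

Lemma nat_of_stack_map_bit (bs : seq bool) g :
  nat_of_stack (map bit (g :: bs)) = g + (nat_of_stack (map bit bs)).*2.
Proof. by rewrite /= isone_bit. Qed.

Lemma digits_add n c ys zs : size ys <= n -> size zs <= n ->
  let: (bs, c') := digits carry_add n c ys zs in
  nat_of_stack (map bit (rcons bs c')) = nat_of_stack ys + nat_of_stack zs + c.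
Proof.
elim: n c ys zs => [|n IH] c ys zs.
  by case: ys => //; case: zs => // _ _ /=; rewrite isone_bit; nlia.
move=> ys_n zs_n; rewrite [nat_of_stack ys]nat_of_stack_step [nat_of_stack zs]nat_of_stack_step /=.
have := IH (carry_add (top_bit (ohead ys)) (top_bit (ohead zs)) c) (behead ys) (behead zs).
rewrite !size_behead => /(_ _ _)/wrap[]; [nlia|nlia|].
case: (digits _ _ _ _ _) => bs c' E.
rewrite rcons_cons nat_of_stack_map_bit E /carry_add.
by case: (top_bit (ohead ys)); case: (top_bit (ohead zs)); case: c {E} => /=; nlia.
Qed.

(** The equation avoids subtraction: a final borrow stands for a missing 2^n. *)
Lemma digits_sub n c ys zs : size ys <= n -> size zs <= n ->
  let: (bs, c') := digits carry_sub n c ys zs in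
  nat_of_stack (map bit bs) + nat_of_stack ys + c = nat_of_stack zs + c' * 2 ^ n.
Proof.
elim: n c ys zs => [|n IH] c ys zs.
  by case: ys => //; case: zs => // _ _ /=; nlia.
move=> ys_n zs_n; rewrite [nat_of_stack ys]nat_of_stack_step [nat_of_stack zs]nat_of_stack_step /=.
have := IH (carry_sub (top_bit (ohead ys)) (top_bit (ohead zs)) c) (behead ys) (behead zs).
rewrite !size_behead => /(_ _ _)/wrap[]; [nlia|nlia|].
case: (digits _ _ _ _ _) => bs c'.
rewrite nat_of_stack_map_bit expnS /carry_sub.
case: (top_bit (ohead ys)); case: (top_bit (ohead zs)); case: c => /= E;
  by case: c' E => /=; nlia.
Qed.

Lemma nat_of_stack_map_bit_lt (bs : seq bool) : nat_of_stack (map bit bs) < 2 ^ size bs.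
Proof.
elim: bs => [|b bs IH] //; rewrite nat_of_stack_map_bit expnS.
by rewrite -[X in 2 ^ X]/(size bs); case: b; nlia.
Qed.

Definition addm y z := seqm (digitm carry_add y z) (seqm (move_to T y) (move_to S z)).

(** The last carry is kept as a digit even when it is 0. Leading zeros are never trimmed, so all
    costs are expressed by lengths. *)
Lemma does_add y z s : y != z -> y \notin [:: T; S] -> z \notin [:: T; S] ->
  s T = [::] -> s S = [::] ->
  exists l, [/\ does (addm y z) s (3 * (size (s y) + size (s z)) + 4) (upd s z l),
    nat_of_stack l = nat_of_stack (s y) + nat_of_stack (s z)
    & size l = (maxn (size (s y)) (size (s z))).+1].
Proof.
move=> nyz nyTS nzTS sT sS.
have [n nE] : exists n, maxn (size (s y)) (size (s z)) = n by eexists.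
have D := @runs_digit carry_add _ _ false _ _ nE nyz nyTS nzTS.
move: nyTS nzTS; rewrite !inE !negb_or => /andP[nyT nyS] /andP[nzT nzS].
have [yn zn] : size (s y) <= n /\ size (s z) <= n by nlia.
have := @digits_add n false (s y) (s z) yn zn.
have := @size_digits carry_add n false (s y) (s z).
case: (digits _ _ _ _ _) D => bs c D /= szbs numE.
exists (map bit (rcons bs c)); split; first last.
- by rewrite nE size_map size_rcons szbs.
- by rewrite numE addn0.
apply: (@does_le _ _ _ _ (n.+1 + ((size (s y)).+1 + n.+2))).
  by nlia.
apply: (does_seq (s1 := _)); first by exists n.+1; [|exact: D].
set s1 := upd _ S _.
have s1T : s1 T = rev (s y).
  by rewrite /s1 /upd nTS eqxx sT.
have s1S : s1 S = bit c :: rev (map bit bs) by rewrite /s1 /upd eqxx sS.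
have s1y : s1 y = [::].
  by rewrite /s1 /upd (negPf nyT) (negPf nyS) eqxx (negPf nyz).
have D1 : does (move_to T y) s1 (size (s y)).+1 (upd (upd s1 T [::]) y (s y)).
  have := @does_move T y s1; rewrite eq_sym nyT s1T size_rev => /(_ isT).
  by rewrite s1y -[catrev _ _]/(rev _) revK.
apply: (does_seq D1).
set s2 := upd _ y _.
have s2S : s2 S = bit c :: rev (map bit bs).
  by rewrite /s2 /upd [S == y]eq_sym (negPf nyS) nST.
have := @does_move S z s2; rewrite eq_sym nzS s2S /= size_rev size_map szbs => /(_ isT).
congr does; apply/funext => j; rewrite /s2 /s1 /upd.
rewrite (negPf nzT) (negPf nzS) eqxx [z == y]eq_sym (negPf nyz).
case: eqP => [_|nz].
  by rewrite catrevE revK map_rcons cats1.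
case: eqP => [->|_]; first by rewrite sS.
case: eqP => [-> //|_].
by case: eqP => [->|_]; rewrite ?sT //; case: eqP.
Qed.

(** The final borrow tells whether the result would be negative; in that case the digits are
    discarded, which yields truncated subtraction. *)
Definition subm y z := seqm (digitm carry_sub y z) (seqm (move_to T y)
  (switchm S (fun a => if top_bit a then clear S else move_to S z))).

Lemma does_sub y z s : y != z -> y \notin [:: T; S] -> z \notin [:: T; S] ->
  s T = [::] -> s S = [::] ->
  exists l, [/\ does (subm y z) s (3 * (size (s y) + size (s z)) + 4) (upd s z l),
    nat_of_stack l = nat_of_stack (s z) - nat_of_stack (s y)
    & size l <= maxn (size (s y)) (size (s z))].
Proof.
move=> nyz nyTS nzTS sT sS.
have [n nE] : exists n, maxn (size (s y)) (size (s z)) = n by eexists.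
have D := @runs_digit carry_sub _ _ false _ _ nE nyz nyTS nzTS.
move: nyTS nzTS; rewrite !inE !negb_or => /andP[nyT nyS] /andP[nzT nzS].
have [yn zn] : size (s y) <= n /\ size (s z) <= n by nlia.
have := @digits_sub n false (s y) (s z) yn zn.
have := @size_digits carry_sub n false (s y) (s z).
case: (digits _ _ _ _ _) D => bs c D /= szbs numE.
exists (if c then [::] else map bit bs); split; first last.
- by case: c {D numE}; rewrite nE // size_map szbs.
(* With a borrow, digits below 2^n force the subtrahend to be the larger number, so the truncated
   difference is 0. *)
- have := nat_of_stack_map_bit_lt bs; rewrite szbs.
  by case: c {D} numE => /=; nlia.
apply: (@does_le _ _ _ _ (n.+1 + ((size (s y)).+1 + n.+2))).
  by nlia.
apply: (does_seq (s1 := _)); first by exists n.+1; [|exact: D].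
set s1 := upd _ S _.
have s1T : s1 T = rev (s y).
  by rewrite /s1 /upd nTS eqxx sT.
have s1S : s1 S = bit c :: rev (map bit bs) by rewrite /s1 /upd eqxx sS.
have s1y : s1 y = [::].
  by rewrite /s1 /upd (negPf nyT) (negPf nyS) eqxx (negPf nyz).
have D1 : does (move_to T y) s1 (size (s y)).+1 (upd (upd s1 T [::]) y (s y)).
  have := @does_move T y s1; rewrite eq_sym nyT s1T size_rev => /(_ isT).
  by rewrite s1y -[catrev _ _]/(rev _) revK.
apply: (does_seq D1).
set s2 := upd _ y _.
have s2S : s2 S = bit c :: rev (map bit bs).
  by rewrite /s2 /upd [S == y]eq_sym (negPf nyS) nST.
apply: does_switch; rewrite s2S /= isone_bit.
set s3 := upd s2 S _.
have s3S : s3 S = rev (map bit bs) by rewrite /s3 upd_same.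
have rest j : j != S -> j != z -> s3 j = s j.
  move=> nS nz; rewrite /s3 /s2 /s1 /upd (negPf nS) (negPf nz).
  case: eqP => [-> //|_].
  by case: eqP => [->|_]; rewrite ?sT.
have s3z : s3 z = [::].
  by rewrite /s3 /s2 /s1 /upd (negPf nzS) (negPf nzT) eqxx [z == y]eq_sym (negPf nyz).
clearbody s3; case cE: c.
  have := does_clear S s3; rewrite s3S size_rev size_map szbs.
  congr does; apply/funext => j; rewrite {1}/upd [RHS]/upd.
  case: (eqVneq j S) => [->|nS]; first by rewrite eq_sym (negPf nzS) sS.
  by case: (eqVneq j z) => [->|nz]; rewrite ?s3z // rest.
have := @does_move S z s3; rewrite eq_sym nzS s3S /= size_rev size_map szbs => /(_ isT).
congr does; apply/funext => j; rewrite {1}/upd [RHS]/upd.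
case: (eqVneq j z) => [_|nz]; first by rewrite catrevE revK s3z cats0.
by rewrite /upd; case: (eqVneq j S) => [->|nS]; rewrite ?sS // rest.
Qed.

(** Horner's scheme: pouring [x] puts its most significant digit on top of [X]; each turn doubles
    [Z] by pushing a 0 and adds [y] if the digit is 1. *)
Definition mulm x y := seqm
  (pourm x (fun a k => if (k == X) || (k == T) then Some a else None))
  (seqm (move_to T x)
    (loopm X (fun g => if isone g then seqm (pushm Z (bit false)) (addm y Z)
                       else pushm Z (bit false)))).

(** [B] is a budget of length. A turn uses up a digit of [X], worth 2, while doubling and adding
    lengthen [Z] by at most 2 unless [y] is longer; the first inequality on [B] covers that case. *)
Lemma does_mul_loop y s B : y \notin [:: T; S; X; Z] -> s T = [::] -> s S = [::] ->
  (size (s X)).*2 <= B -> size (s Z) + (size (s X)).*2 <= size (s y) + B ->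
  exists l, [/\ does (loopm X (fun g => if isone g
        then seqm (pushm Z (bit false)) (addm y Z) else pushm Z (bit false))) s
      (size (s X) * (6 * size (s y) + 3 * B + 10) + 1) (upd (upd s X [::]) Z l),
    nat_of_stack l =
      nat_of_stack (s Z) * 2 ^ size (s X) + nat_of_stack (rev (s X)) * nat_of_stack (s y)
    & size l <= size (s y) + B].
Proof.
move=> yN; move: (yN); rewrite !inE !negb_or => /and4P[nyT nyS nyX nyZ].
move E: (s X) => m; elim: m s E => [|g m IH] s sX sT sS szB szZ.
  exists (s Z); split; [|by rewrite /rev /=; nlia|by rewrite /= in szZ; nlia].
  have -> : upd (upd s X [::]) Z (s Z) = s.
    by apply/funext => j; rewrite /upd; case: eqP => [-> //|_]; case: eqP => [->|].
  exact: does_loop0.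
rewrite /= in szB szZ.
pose s2 := upd (upd s X m) Z (bit false :: s Z).
have s2E j : j != X -> j != Z -> s2 j = s j.
  by move=> nX nZ; rewrite /s2 !upd_diff.
have push_s2 : does (pushm Z (bit false)) (upd s X m) 1 s2.
  by have := does_push Z (bit false) (upd s X m); rewrite (upd_diff _ _ (negbT nZX)).
have [t [l1 [run1 t_le sz1 num1]]] : exists t l1, [/\
    does (if isone g then seqm (pushm Z (bit false)) (addm y Z)
          else pushm Z (bit false)) (upd s X m) t (upd s2 Z l1),
    t <= 6 * size (s y) + 3 * B + 8, size l1 + (size m).*2 <= size (s y) + B
    & nat_of_stack l1 = (nat_of_stack (s Z)).*2 + isone g * nat_of_stack (s y)].
  have s2Z : s2 Z = bit false :: s Z by rewrite /s2 upd_same.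
  case: (isone g).
    have [||||l1] := @does_add y Z s2 nyZ.
    - by rewrite !inE negb_or nyT.
    - by rewrite !inE negb_or nZT nZS.
    - by rewrite s2E ?nTX ?nTZ.
    - by rewrite s2E ?nSX ?nSZ.
    rewrite s2Z s2E //= => -[run1 num1 sz1].
    exists (1 + (3 * (size (s y) + (size (s Z)).+1) + 4)), l1; split.
    - exact: does_seq push_s2 run1.
    - by nlia.
    - by rewrite sz1; nlia.
    - by rewrite num1 isone_bit; nlia.
  exists 1, (bit false :: s Z); split.
  - suff -> : upd s2 Z (bit false :: s Z) = s2 by [].
    by apply/funext => j; rewrite /s2 /upd; case: eqP.
  - by nlia.
  - by rewrite /=; nlia.
  - by rewrite /= isone_bit; nlia.
have [|||||l] := IH (upd s2 Z l1).
- by rewrite upd_diff ?nXZ // /s2 upd_diff ?nXZ // upd_same.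
- by rewrite upd_diff ?nTZ // s2E ?nTX ?nTZ.
- by rewrite upd_diff ?nSZ // s2E ?nSX ?nSZ.
- by nlia.
- by rewrite upd_same upd_diff // s2E.
rewrite upd_same upd_diff // s2E // => -[run2 num2 sz2].
exists l; split=> //; last first.
  rewrite num2 num1 /= rev_cons nat_of_stack_rcons size_rev expnS -muln2.
  by move: (2 ^ _) => p; case: (isone g); nlia.
have -> : upd (upd s X [::]) Z l = upd (upd (upd s2 Z l1) X [::]) Z l.
  by apply/funext => j; rewrite /s2 /upd; do !case: eqP.
by apply: does_le (does_loopS sX run1 run2); rewrite /= mulSn; nlia.
Qed.

Lemma does_mul x y s : x \notin [:: T; S; X; Z] -> y \notin [:: T; S; X; Z] ->
  s T = [::] -> s S = [::] -> s X = [::] -> s Z = [::] ->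
  exists l, [/\ does (mulm x y) s
      (size (s x) * (6 * size (s y) + 6 * size (s x) + 12) + 3) (upd s Z l),
    nat_of_stack l = nat_of_stack (s x) * nat_of_stack (s y)
    & size l <= size (s y) + (size (s x)).*2].
Proof.
move=> xN yN sT sS sX sZ.
move: (xN) (yN); rewrite !inE !negb_or.
move=> /and4P[nxT nxS nxX nxZ] /and4P[nyT nyS nyX nyZ].
pose s1 := upd (upd (upd s x [::]) X (rev (s x))) T (rev (s x)).
have run1 : does (pourm x (fun a k => if (k == X) || (k == T) then Some a else None))
    s (size (s x)).+1 s1.
  have := does_pour x (fun a k => if (k == X) || (k == T) then Some a else None) s.
  congr does; apply/funext => j; rewrite /s1 /upd.
  case: (eqVneq j x) => [->|_]; first by rewrite (negPf nxT) (negPf nxX).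
  have idE l : pmap (fun a : G => Some a) l = l by elim: l => //= a l ->.
  case: (eqVneq j T) => [->|_]; first by rewrite orbT idE sT.
  case: (eqVneq j X) => [->|_]; first by rewrite idE sX.
  by elim: (s x).
pose s2 := upd s X (rev (s x)).
have run2 : does (move_to T x) s1 (size (s x)).+1 s2.
  have := @does_move T x s1; rewrite eq_sym nxT => /(_ isT).
  have -> : s1 T = rev (s x) by rewrite /s1 upd_same.
  have -> : s1 x = [::].
    by rewrite /s1 upd_diff // upd_diff // upd_same.
  rewrite size_rev; congr does; apply/funext => j; rewrite /s1 /s2 /upd.
  case: (eqVneq j x) => [->|_]; first by rewrite (negPf nxX) -[catrev _ _]/(rev _) revK.
  by case: (eqVneq j T) => [->|//]; rewrite nTX sT.
have s2E j : j != X -> s2 j = s j by move=> nX; rewrite /s2 upd_diff.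
have s2Z : s2 Z = [::] by rewrite s2E ?nZX.
have s2y := s2E y nyX.
have s2X : s2 X = rev (s x) by rewrite /s2 upd_same.
have [||||l] := @does_mul_loop y s2 (size (s x)).*2 yN.
- by rewrite s2E ?nTX.
- by rewrite s2E ?nSX.
- by rewrite s2X size_rev.
- by rewrite s2Z s2y s2X size_rev /= add0n leq_addl.
rewrite s2X s2y s2Z revK size_rev => -[run3 num3 sz3].
exists l; split=> //.
have -> : upd s Z l = upd (upd s2 X [::]) Z l.
  by apply/funext => j; rewrite /s2 /upd; case: eqP => // _; case: eqP => // ->.
apply: does_le (does_seq run1 (does_seq run2 run3)). rewrite -!muln2; nlia.
Qed.

(** The product travels through [T] because a single move would reverse it. *)
Definition mulbym x y :=
  seqm (mulm x y) (seqm (clear y) (seqm (move_to Z T) (move_to T y))).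

Lemma does_mulby x y s : x \notin [:: T; S; X; Z] -> y \notin [:: T; S; X; Z] ->
  s T = [::] -> s S = [::] -> s X = [::] -> s Z = [::] ->
  exists l, [/\ does (mulbym x y) s
      ((size (s x)).+1 * (6 * size (s y) + 6 * size (s x) + 12) + 6) (upd s y l),
    nat_of_stack l = nat_of_stack (s x) * nat_of_stack (s y)
    & size l <= size (s y) + (size (s x)).*2].
Proof.
move=> xN yN sT sS sX sZ.
have [l [run1 numl szl]] := does_mul xN yN sT sS sX sZ.
move: (xN) (yN); rewrite !inE !negb_or.
move=> /and4P[nxT nxS nxX nxZ] /and4P[nyT nyS nyX nyZ].
exists l; split=> //.
have := does_clear y (upd s Z l); rewrite upd_diff // => run2.
have := @does_move Z T (upd (upd s Z l) y [::]); rewrite nZT => /(_ isT).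
set s3 := upd (upd (upd _ _ _) _ _) _ _ => run3.
have := @does_move T y s3; rewrite eq_sym nyT => /(_ isT).
have E : upd (upd s Z l) y [::] Z = l by rewrite upd_diff ?upd_same // eq_sym.
have E' : upd (upd s Z l) y [::] T = [::].
  by rewrite upd_diff ?upd_diff ?nTZ // eq_sym.
have -> : s3 T = rev l by rewrite /s3 upd_same E E'.
have -> : s3 y = [::].
  by rewrite /s3 upd_diff // upd_diff // upd_same.
set s4 := upd (upd _ _ _) _ _ => run4.
have -> : upd s y l = s4.
  apply/funext => j; rewrite /s4 /s3 /upd; case: (j =P y) => [_|_].
    by rewrite -[catrev _ _]/(rev _) revK.
  case: (j =P T) => [-> //|_].
  by case: (j =P Z) => [-> //|_].
rewrite E in run3; rewrite size_rev in run4.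
by apply: does_le (does_seq run1 (does_seq run2 (does_seq run3 run4))); nlia.
Qed.

End Registers.
End Arithmetic.

(** * Querying the given machine *)

(** Whatever follows the output on its tape starts with a blank or is empty, so a reader knows where
    to stop. *)
Lemma nonblank_prefixP (S : Type) (r : seq (option S)) :
  exists2 junk, r = map Some (nonblank_prefix r) ++ junk & head None junk = None.
Proof.
elim: r => [|[a|] r [junk E J]] /=; first by exists [::].
  by exists junk => //; rewrite -E.
by exists (None :: r).
Qed.

Section Call.
Variables (M : machine) (J : finType).
Hypothesis detM : deterministic M.
Variables (inp : option bool -> sym M) (outp : option bool -> sym M).
Hypothesis outp_inj : injective outp.
Variables RR U p q T F : J.
Hypothesis uniq_regs : uniq [:: RR; U; p; q; T; F].

Notation G := (stack_sym M (option trit)).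
(** Bits share their symbols with the letters 1 and -1, so [inr (Some _)] embeds the whole output
    alphabet of bits and separator. *)
Definition bit (b : bool) : G := inr (Some (Some b)).
Definition isone (g : G) : bool := g == bit true.
Lemma isone_bit b : isone (bit b) = b.
Proof.
by rewrite /isone; case: b; [exact: eqxx | apply/negbTE/eqP; case].
Qed.

Notation stacks := (@tape_stacks M J (option trit)).
Notation machine := (smach (stack_name M J) G).
Implicit Types (e : store J G) (t : 'I_(tapes M).+1 -> tape (sym M)).

Lemma upd_stacks e t j l : upd (stacks e t) (inl j) l = stacks (upd e j l) t.
Proof.
apply/funext => -[k|[k b]]; rewrite /upd //=.
Qed.

Definition decode (g : option G) : option (option bool) :=
  if g is Some (inl (Some a)) then [pick o | outp o == a] else None.

Lemma decode_outp o : decode (Some (inl (Some (outp o)))) = Some o.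
Proof.
rewrite /decode; case: pickP => [b /eqP/outp_inj -> //|/(_ o)].
by rewrite eqxx.
Qed.

Notation R := (right_of J ord_max).
(* States of the reader: before the sign, in the numerator, in the denominator.
   They remember the sign and whether the denominator is known to be nonzero. *)
Definition read_state : finType := (unit + (bool + bool * bool))%type.

(** Answers have the most significant bit first, so pushing them leaves the least significant bit on
    top, as the arithmetic expects. Malformed words are parsed as [rat_of_word] does: a missing sign
    is positive and later separators are skipped. [F] is raised when the sign is positive and the
    denominator nonzero. *)
Definition readm : machine :=
  @SMach _ G read_state (inl tt) (fun s x =>
    let popR (w : option (stack_name M J)) (b : bool) i :=
      if i == R then None else if Some i == w then op_push (bit b) (x i)
      else op_keep (x i) in
    match s, decode (x R) with
    | inl _, Some (Some neg) => (Some (inr (inl neg)), popR None false)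
    | inl _, Some None => (Some (inr (inr (false, false))), popR None false)
    | inr (inl neg), Some (Some b) => (Some (inr (inl neg)), popR (Some (inl p)) b)
    | inr (inl neg), Some None => (Some (inr (inr (neg, false))), popR None false)
    | inr (inr (neg, nz)), Some (Some b) =>
        (Some (inr (inr (neg, nz || b))), popR (Some (inl q)) b)
    | inr (inr (neg, nz)), Some None => (Some (inr (inr (neg, nz))), popR None false)
    | inr (inr (false, true)), None =>
        (None, fun i => if i == inl F then op_push (bit true) (x i) else op_keep (x i))
    | _, None => (None, fun i => op_keep (x i))
    end).

Let npq : (p == q) = false.
Proof. by move: uniq_regs; rewrite /= !inE; case: (p == q); rewrite ?orbT ?andbF. Qed.
Let npF : (p == F) = false.
Proof. by move: uniq_regs; rewrite /= !inE; case: (p == F); rewrite ?orbT ?andbF. Qed.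
Let nqF : (q == F) = false.
Proof. by move: uniq_regs; rewrite /= !inE; case: (q == F); rewrite ?orbT ?andbF. Qed.

Let inlE (a b : J) : ((inl a : stack_name M J) == inl b) = (a == b).
Proof. by apply: inj_eq => ? ? []. Qed.

Definition cells (v : seq (option bool)) (junk : seq (option (sym M))) : seq G :=
  map inl (map Some (map outp v) ++ junk).

Lemma decode_junk junk : head None junk = None ->
  decode (ohead (cells [::] junk)) = None.
Proof. by case: junk => [|[a|] junk]. Qed.

(** A denominator is nonzero exactly when it has a digit 1; [nz] records those already read, as the
    induction requires. *)
Lemma runs_read_den neg nz v junk (s : store (stack_name M J) G) :
  head None junk = None -> s R = cells v junk ->
  let den := pmap id v in
  runs (inr (inr (neg, nz)) : ctl readm) s (size v).+1
    (upd (upd (upd s R (cells [::] junk))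
       (inl q) (catrev (map bit den) (s (inl q))))
       (inl F) (if ~~ neg && (nz || has id den) then bit true :: s (inl F) else s (inl F))).
Proof.
move=> hj; elim: v nz s => [|a v IH] nz s sR den.
  set f := (X in runs _ _ _ X).
  have -> : f = apply_ops (fun i => if ~~ neg && nz && (i == inl F)
      then op_push (bit true) (top s i) else op_keep (top s i)) s.
    apply/funext => i; rewrite /f /apply_ops /upd orbF /= -sR.
    case: (i =P inl F) => [->|_].
      by rewrite andbT; case: ifP => _; rewrite ?op_pushK ?op_keepK.
    rewrite andbF op_keepK; case: (i =P inl q) => [-> //|_].
    by case: (i =P R) => [->|].
  have decE : decode (top s R) = None by rewrite /top sR decode_junk.
  by apply: runs_last; rewrite /= decE; case: neg {den f}; case: nz.
pose l := if a is Some b then bit b :: s (inl q) else s (inl q).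
pose s2 := upd (upd s R (cells v junk)) (inl q) l.
have s2R : s2 R = cells v junk by rewrite /s2 /upd /= eqxx.
have s2q : s2 (inl q) = l by rewrite /s2 /upd eqxx.
have s2F : s2 (inl F) = s (inl F).
  by rewrite /s2 /upd /= inlE eq_sym nqF.
have := IH (nz || (a == Some true)) s2 s2R; rewrite /= s2q s2F.
set f := (X in runs _ _ _ X -> _); set f' := (X in _ -> runs _ _ _ X).
have -> : f' = f.
  apply/funext => i; rewrite /f /f' /den /s2 /upd.
  case: (i =P inl F) => [_|_]; first by case: (a) => [[]|] /=; rewrite ?orbT ?orbF ?orbA ?orbT.
  case: (i =P inl q) => [_|nq]; first by rewrite /l; case: (a).
  by case: (i =P R).
have decE : decode (top s R) = Some a by rewrite /top sR; apply: decode_outp.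
pose o i := if i == R then None else
  if (i == inl q) && (a != None) then op_push (bit (a == Some true)) (top s i)
  else op_keep (top s i).
have -> : s2 = apply_ops o s.
  apply/funext => i; rewrite /apply_ops /o /s2 /upd /l.
  case: (i =P inl q) => [->|_] /=.
    by case: (a) => [[]|]; rewrite ?op_pushK ?op_keepK.
  by case: (i =P R) => [->|_]; rewrite ?op_keepK ?sR.
apply: (@runs_more _ _ readm) => /=; rewrite decE.
rewrite /o; case: (a) => [b|]; rewrite ?orbF.
  have -> : (Some b == Some true) = b by case: b.
  by case: (neg); case: (nz); congr pair; apply/funext => i; rewrite andbT.
by case: (neg); case: (nz); congr pair; apply/funext => i; rewrite andbF.
Qed.

Lemma runs_read_num neg v junk (s : store (stack_name M J) G) :
  head None junk = None -> s R = cells v junk ->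
  let num := pmap id (take (index None v) v) in
  let den := pmap id (drop (index None v) v) in
  runs (inr (inl neg) : ctl readm) s (size v).+1
    (upd (upd (upd (upd s R (cells [::] junk))
       (inl p) (catrev (map bit num) (s (inl p))))
       (inl q) (catrev (map bit den) (s (inl q))))
       (inl F) (if ~~ neg && has id den then bit true :: s (inl F) else s (inl F))).
Proof.
move=> hj; elim: v s => [|[b|] v IH] s sR num den.
- set f := (X in runs _ _ _ X).
  have -> : f = apply_ops (fun i => op_keep (top s i)) s.
    rewrite apply_keep; apply/funext => i; rewrite /f /upd /= andbF.
    case: (i =P inl F) => [-> //|_]; case: (i =P inl q) => [-> //|_].
    by case: (i =P inl p) => [-> //|_]; case: (i =P R) => [->|].
  have decE : decode (top s R) = None by rewrite /top sR decode_junk.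
  by apply: runs_last; rewrite /= decE; case: (neg).
- pose s2 := upd (upd s R (cells v junk)) (inl p) (bit b :: s (inl p)).
  have s2R : s2 R = cells v junk by rewrite /s2 /upd /= eqxx.
  have s2p : s2 (inl p) = bit b :: s (inl p) by rewrite /s2 /upd eqxx.
  have s2q : s2 (inl q) = s (inl q).
    by rewrite /s2 /upd /= inlE eq_sym npq.
  have s2F : s2 (inl F) = s (inl F).
    by rewrite /s2 /upd /= inlE eq_sym npF.
  have := IH s2 s2R; rewrite /= s2p s2q s2F.
  set f := (X in runs _ _ _ X -> _); set f' := (X in _ -> runs _ _ _ X).
  have -> : f' = f.
    apply/funext => i; rewrite /f /f' /num /den /s2 /upd.
    case: (i =P inl F) => [//|_]; case: (i =P inl q) => [//|_].
    by case: (i =P inl p) => [//|_]; case: (i =P R).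
  have decE : decode (top s R) = Some (Some b) by rewrite /top sR; apply: decode_outp.
  pose o i := if i == R then None else
    if Some i == Some (inl p) then op_push (bit b) (top s i) else op_keep (top s i).
  have -> : s2 = apply_ops o s.
    apply/funext => i; rewrite /apply_ops /o /s2 /upd.
    case: (i =P inl p) => [->|/eqP/negPf np] /=; first by rewrite eqxx op_pushK.
    rewrite (inj_eq Some_inj) np.
    by case: (i =P R) => [->|_]; rewrite ?op_keepK ?sR.
  by apply: (@runs_more _ _ readm) => /=; rewrite decE; case: (neg).
pose s2 := upd s R (cells v junk).
have s2R : s2 R = cells v junk by rewrite /s2 /upd eqxx.
have := runs_read_den neg false hj s2R; rewrite /= -/den.
set f := (X in runs _ _ _ X -> _); set f' := (X in _ -> runs _ _ _ X).
have -> : f' = f.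
  apply/funext => i; rewrite /f /f' /num /den /s2 /upd /=.
  case: (i =P inl F) => [//|_]; case: (i =P inl q) => [//|_].
  by case: (i =P inl p) => [->|_]; case: (i =P R).
have decE : decode (top s R) = Some None by rewrite /top sR; apply: decode_outp.
pose o i := if i == R then None else op_keep (top s i).
have -> : s2 = apply_ops o s.
  apply/funext => i; rewrite /apply_ops /o /s2 /upd.
  by case: (i =P R) => [->|_]; rewrite ?op_keepK ?sR.
by apply: (@runs_more _ _ readm) => /=; rewrite decE; case: (neg).
Qed.

Lemma runs_read v junk (s : store (stack_name M J) G) :
  head None junk = None -> s R = cells v junk ->
  let num := pmap id (take (index None v) v) in
  let den := pmap id (drop (index None v) v) in
  runs (entry readm) s (size v).+1
    (upd (upd (upd (upd s R (cells [::] junk))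
       (inl p) (catrev (map bit (behead num)) (s (inl p))))
       (inl q) (catrev (map bit den) (s (inl q))))
       (inl F) (if ~~ head false num && has id den then bit true :: s (inl F)
                else s (inl F))).
Proof.
move=> hj; case: v => [|a v] sR num den.
  set f := (X in runs _ _ _ X).
  have -> : f = apply_ops (fun i => op_keep (top s i)) s.
    rewrite apply_keep; apply/funext => i; rewrite /f /upd /=.
    case: (i =P inl F) => [-> //|_]; case: (i =P inl q) => [-> //|_].
    by case: (i =P inl p) => [-> //|_]; case: (i =P R) => [->|].
  have decE : decode (top s R) = None by rewrite /top sR decode_junk.
  by apply: runs_last; rewrite /= decE.
pose s2 := upd s R (cells v junk).
have s2R : s2 R = cells v junk by rewrite /s2 /upd eqxx.
have decE : decode (top s R) = Some a by rewrite /top sR; apply: decode_outp.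
pose o i := if i == R then None else op_keep (top s i).
have s2E : s2 = apply_ops o s.
  apply/funext => i; rewrite /apply_ops /o /s2 /upd.
  by case: (i =P R) => [->|_]; rewrite ?op_keepK ?sR.
case: a @num @den sR decE => [b|] num den sR decE.
  have act1 : act (inl tt : ctl readm) (top s) = (Some (inr (inl b)), o).
    by rewrite /= decE.
  apply: (runs_more act1); rewrite -s2E.
  have := runs_read_num b hj s2R; congr runs; apply/funext => i.
  rewrite /s2 /upd /=; case: (i =P inl F) => [//|_]; case: (i =P inl q) => [//|_].
  by case: (i =P inl p) => [//|_]; case: (i =P R).
have act1 : act (inl tt : ctl readm) (top s) = (Some (inr (inr (false, false))), o).
  by rewrite /= decE.
apply: (runs_more act1); rewrite -s2E.
have := runs_read_den false false hj s2R; congr runs; apply/funext => i.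
rewrite /s2 /upd /=; case: (i =P inl F) => [//|_]; case: (i =P inl q) => [//|_].
by case: (i =P inl p) => [->|_]; case: (i =P R).
Qed.

Definition loadm (i : J) (f : G -> option (sym M)) : machine :=
  seqm (pourm (inl i) (fun a k => if k == inl T then Some a
          else if k == right_of J ord0 then Some (inl (f a)) else None))
    (move_to (I := stack_name M J) G (inl T) (inl i)).

Lemma does_load i f e t : i != T -> e T = [::] ->
  does (loadm i f) (stacks e t) ((size (e i)).*2 + 2)
    (stacks e (fun j => if j == ord0 then ((t j).1, catrev (map f (e i)) (t j).2) else t j)).
Proof.
move=> niT eT.
have run1 := does_pour (inl i) (fun a k => if k == inl T then Some a
  else if k == right_of J ord0 then Some (inl (f a)) else None) (stacks e t).
set t' := fun j : 'I_(tapes M).+1 => _.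
set s1 := (X in does _ _ _ X) in run1.
have s1E : s1 = stacks (upd (upd e i [::]) T (rev (e i))) t'.
  have catrev_map (T1 T2 : Type) (g : T1 -> T2) l r :
      catrev (map g l) (map g r) = map g (catrev l r).
    by elim: l r => //= a l IH r; rewrite -IH.
  have pmapE k : pmap (fun a => if k == inl T then Some a
      else if k == right_of J ord0 then Some (inl (f a) : G) else None) (e i) =
      if k == inl T then e i else
      if k == right_of J ord0 then map inl (map f (e i)) else [::].
    elim: (e i) => [|a l /= ->]; case: (k == inl T) => //.
      by case: ifP.
    by case: (k == right_of J ord0).
  apply/funext => k; rewrite /s1 pmapE {pmapE}; case: k => [j|[j b]].
    rewrite !inlE /= /upd; case: (j =P i) => [->|_]; first by rewrite (negPf niT).
    by case: (j =P T) => [->|_] //; rewrite eT.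
  rewrite /right_of -[inr _ == inr _]/((j, b) == (ord0, true)) xpair_eqE /t' /=.
  by case: (j == ord0); case: b; rewrite //= catrev_map.
have := @does_move (stack_name M J) _ (inl T) (inl i) s1; rewrite inlE eq_sym niT => /(_ isT).
rewrite s1E !upd_stacks /= upd_same upd_diff // upd_same size_rev.
rewrite -[catrev _ _]/(rev _) revK => run2.
rewrite s1E in run1.
have -> : stacks e t' = stacks (upd (upd (upd (upd e i [::]) T (rev (e i))) T [::]) i (e i)) t'.
  congr stacks; apply/funext => j; rewrite /upd.
  by case: (j =P i) => [-> //|_]; case: (j =P T) => [->|].
by apply: does_le (does_seq run1 run2); rewrite -addnn /=; lia.
Qed.

Definition blank (j : 'I_(tapes M).+1) : tape (sym M) := blank_tape (sym M).

(** The query is assembled from its end: the unary precision, then the bit 1, then the word on [U],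
    whose last symbol is on top. The recursion only ever asks for words ending in 1. If [F] is not
    raised, the answer is replaced by 0/1. *)
Definition callm : machine :=
  seqm (loadm RR (fun _ => Some (inp None)))
  (seqm (pushm (right_of J ord0) (inl (Some (inp (Some true)))))
  (seqm (loadm U (fun g => Some (inp (Some (isone g)))))
  (seqm (simm M J (option trit))
  (seqm readm
  (seqm (scrubm M J (option trit))
  (switchm (inl F) (fun a => if a is Some _ then clear G (inl F : stack_name M J)
     else seqm (clear G (inl p : stack_name M J))
       (seqm (clear G (inl q : stack_name M J))
         (pushm (inl q : stack_name M J) (bit true)))))))))).

Lemma nat_of_stack_rev_bits (bs : seq bool) :
  nat_of_stack isone (rev (map bit bs)) = nat_of_bits bs.
Proof.
rewrite -map_rev; elim/last_ind: bs => [//|bs b IH].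
rewrite rev_rcons /= IH isone_bit /nat_of_bits -cats1 foldl_cat /=.
by rewrite addnC.
Qed.

Lemma nat_of_bits_gt0 (bs : seq bool) : (0 < nat_of_bits bs) = has id bs.
Proof.
elim/last_ind: bs => [//|bs b IH].
rewrite /nat_of_bits -cats1 foldl_cat has_cat /= -/(nat_of_bits bs) orbF -IH.
by case: b; lia.
Qed.

(** A negative sign gives a value at most 0, and a zero denominator gives 0 because the inverse of 0
    is 0; in both cases the maximum is 0. *)
Lemma rat_of_word_max (v : seq (option bool)) :
  let num := pmap id (take (index None v) v) in
  let den := pmap id (drop (index None v) v) in
  (Num.max 0 (rat_of_word v) = if ~~ head false num && has id den
    then (nat_of_bits (behead num))%:R / (nat_of_bits den)%:R else 0)%R.
Proof.
move=> num den; rewrite /rat_of_word -/num -/den.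
case: ifPn => [/andP[/negPf -> _]|].
  by rewrite expr0 mul1r; apply/max_idPr; rewrite divr_ge0.
rewrite negb_and negbK => /orP[->|].
  by rewrite expr1 mulN1r; apply/max_idPl; rewrite mulNr oppr_le0 divr_ge0.
rewrite -nat_of_bits_gt0 -eqn0Ngt => /eqP ->.
by rewrite invr0 mulr0 maxxx.
Qed.

(** [B] is the length of the query plus two symbols for each of the [n.+1] simulation steps. It
    bounds every tape stack and hence the answer. *)
Lemma does_call e (u : seq bool) n (c : config M) v :
  let w := enc_unary (rcons u true, size (e RR)) in
  e U = map bit (rev u) -> e T = [::] -> e p = [::] -> e q = [::] -> e F = [::] ->
  steps n (init (map inp w)) c -> halted c -> tape_word (c.2 ord_max) = map outp v ->
  let B := size (e RR) + size u + 2 * n + 3 in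
  exists lp lq,
    [/\ does callm (stacks e blank) (10 * B) (stacks (upd (upd e p lp) q lq) blank),
        0 < nat_of_stack isone lq,
        ((nat_of_stack isone lp)%:R / (nat_of_stack isone lq)%:R = Num.max 0 (rat_of_word v))%R,
        size lp <= B & size lq <= B].
Proof.
move=> w eU eT ep eqq eF sts hc out B.
have nRT : RR != T by move: uniq_regs; rewrite /= !inE !negb_or => /andP[/and5P[]].
have nUT : U != T.
  by move: uniq_regs; rewrite /= !inE !negb_or => /and3P[_ /and4P[]].
have run1 := does_load (fun _ => Some (inp None)) blank nRT eT.
set t1 := fun j : 'I_(tapes M).+1 => _ in run1.
have run2 := does_push (right_of J ord0) (inl (Some (inp (Some true)))) (stacks e t1).
pose t2 (j : 'I_(tapes M).+1) := if j == ord0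
  then ([::], Some (inp (Some true)) :: (t1 j).2) else blank j.
set s2 := upd _ _ _ in run2.
have s2E : s2 = stacks e t2.
  apply/funext => -[j|[j b]] //; rewrite /s2 /upd.
  rewrite /right_of -[inr _ == inr _]/((j, b) == (ord0, true)) xpair_eqE /t2 /= /t1.
  by case: (j =P ord0) => [->|_]; case: b.
rewrite {}s2E in run2.
have run3 := does_load (fun g => Some (inp (Some (isone g)))) t2 nUT eT.
set t3 := fun j : 'I_(tapes M).+1 => _ in run3.
have t3E : t3 = (init (map inp w)).2.
  apply/funext => j; rewrite /t3 /t2 /t1 /=; case: (j =P ord0) => [_|//].
  congr pair; rewrite eU -!map_comp catrevE -map_rev revK.
  rewrite /w /enc_unary /= !map_cat !map_rcons cat_rcons -!map_comp !map_nseq.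
  rewrite catrevE cats0.
  congr (_ ++ _ :: _).
    by apply: eq_map => b /=; rewrite isone_bit.
  by elim: (e RR) => //= a l; rewrite rev_cons => ->; elim: l => //= ? ? ->.
rewrite {}t3E in run3.
have run4 : does (simm M J (option trit)) (stacks e (init (map inp w)).2) n.+1 (stacks e c.2).
  by exists n.+1 => //; exact: (runs_sim detM e sts hc).
have [junk rE hj] := nonblank_prefixP (c.2 ord_max).2.
have sR : stacks e c.2 R = cells v junk by rewrite /= rE -/(tape_word _) out.
pose num := pmap id (take (index None v) v).
pose den := pmap id (drop (index None v) v).
have := runs_read hj sR; rewrite -/num -/den; cbv zeta.
set s5 := (X in runs _ _ _ X) => run5.
have szB k : size (stacks e c.2 (inr k)) <= size w + n.+1.*2.
  have [m le_m run] := run4.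
  apply: leq_trans (runs_size (inr k) run) _; apply: leq_add; last by rewrite leq_double.
  by case: k => j [] /=; case: ifP => // _; rewrite size_map //= !size_map.
have szw : size w = (size u).+1 + size (e RR).
  by rewrite /w /enc_unary size_cat size_map size_rcons size_nseq.
have szv : size v <= size w + n.+1.*2.
  by apply: leq_trans (szB (ord_max, true)); rewrite sR /cells size_map size_cat !size_map leq_addr.
have run6 := @does_scrub M J (option trit) s5 (size w + n.+1.*2).
have {run6} := run6 _; case=> [k|k6 le6 run6].
  rewrite /s5 /upd /=; case: (inr k =P R) => [_|_]; last exact: szB.
  apply: leq_trans (szB (ord_max, true)); rewrite sR /cells !size_map /=.
  by rewrite size_cat leq_addl.
set s6 := (X in runs _ _ _ X) in run6.
pose lp := rev (map bit (behead num)); pose lq := rev (map bit den).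
pose lF := if ~~ head false num && has id den then [:: bit true] else [::].
pose e6 := upd (upd (upd e p lp) q lq) F lF.
have s6E : s6 = stacks e6 blank.
  apply/funext => -[j|[j b]]; rewrite /s6; last by case: b.
  by rewrite /s5 /upd !inlE /= ep eqq eF -/lp -/lq -/lF.
rewrite {}s6E in run6.
have does5 : does readm (stacks e c.2) (size v).+1 s5 by exists (size v).+1.
have does6 : does (scrubm M J (option trit)) s5 (size w + n.+1.*2).+1 (stacks e6 blank).
  by exists k6.
have sznum : size num + size den <= size v.
  rewrite /num /den -size_cat -pmap_cat cat_take_drop.
  by rewrite size_pmap; apply: leq_trans (count_size _ _) _.
have szlp : size lp <= size v.
  rewrite size_rev size_map size_behead; apply: leq_trans (leq_pred _) _.
  by apply: leq_trans sznum; apply: leq_addr.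
have szlq : size lq <= size v.
  by rewrite size_rev size_map; apply: leq_trans sznum; apply: leq_addl.
have vB : size v <= B.
  by apply: leq_trans szv _; rewrite szw /B; clear; lia.
have e6F : e6 F = lF by rewrite /e6 upd_same.
have e6p : e6 p = lp.
  by rewrite /e6 upd_diff ?npF // upd_diff ?npq // upd_same.
have e6q : e6 q = lq by rewrite /e6 upd_diff ?nqF // upd_same.
have pre time7 s7 : does (switchm (inl F) (fun a =>
     if a is Some _ then clear G (inl F : stack_name M J)
     else seqm (clear G (inl p : stack_name M J))
       (seqm (clear G (inl q : stack_name M J))
         (pushm (inl q : stack_name M J) (bit true))))) (stacks e6 blank) time7 s7 ->
    time7 <= size lp + size lq + 6 -> does callm (stacks e blank) (10 * B) s7.
  move=> run7 let7.
  apply: does_le (does_seq run1 (does_seq run2 (does_seq run3 (does_seq run4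
    (does_seq does5 (does_seq does6 run7)))))).
  rewrite eU size_map size_rev; move: let7 szlp szlq vB; rewrite szw /B; clear; lia.
have [good|bad] := boolP (~~ head false num && has id den).
  exists lp, lq; rewrite !nat_of_stack_rev_bits nat_of_bits_gt0 rat_of_word_max -/num -/den good.
  split; [|by case/andP: good|by []|exact: leq_trans vB|exact: leq_trans vB].
  apply: (pre 2); last by rewrite addnC.
  apply: does_switch; rewrite /= e6F /lF good /= upd_stacks.
  have := does_clear (inl F : stack_name M J) (stacks (upd e6 F [::]) blank).
  rewrite /= upd_same upd_stacks; congr does; congr stacks; apply/funext => j.
  rewrite /e6 /upd; case: (j =P F) => [->|//].
  by rewrite eF eq_sym nqF eq_sym npF.
have one1 : nat_of_stack isone [:: bit true] = 1.
  by rewrite -[LHS]/(isone (bit true) + 0) isone_bit.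
(* The fraction 0/1, with a positive denominator so that later divisions stay meaningful. *)
exists [::], [:: bit true]; rewrite one1 rat_of_word_max -/num -/den (negPf bad).
rewrite mul0r; split=> //; last by rewrite /B /= addn3.
apply: (pre ((size lp).+1 + ((size lq).+1 + 1)).+1); last by clear; lia.
have e7p : upd e6 F [::] p = lp by rewrite upd_diff ?npF.
have e8q : upd (upd e6 F [::]) p [::] q = lq.
  by rewrite upd_diff ?upd_diff ?nqF // eq_sym npq.
have := does_clear (inl p : stack_name M J) (stacks (upd e6 F [::]) blank).
rewrite /= upd_stacks e7p => run7.
have := does_clear (inl q : stack_name M J) (stacks (upd (upd e6 F [::]) p [::]) blank).
rewrite /= upd_stacks e8q => run8.
have := does_push (inl q : stack_name M J) (bit true)
  (stacks (upd (upd (upd e6 F [::]) p [::]) q [::]) blank).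
rewrite /= upd_stacks upd_same => run9.
apply: does_switch; rewrite /= e6F /lF (negPf bad) /= upd_stacks.
set e7 := (X in does _ _ _ (stacks X _)).
have -> : e7 = upd (upd (upd (upd e6 F [::]) p [::]) q [::]) q [:: bit true].
  apply/funext => j; rewrite /e7 /e6 /upd.
  case: (j =P q) => [//|_]; case: (j =P p) => [//|_].
  by case: (j =P F) => [->|].
exact: does_seq run7 (does_seq run8 run9).
Qed.

End Call.

(** * The lifted gale and the machine computing it *)

Section Lift.
Variable K : realFieldType.
Local Open Scope ring_scope.

(** The state is the projected word together with the value of [D]. The field is arbitrary because
    the same recursion is run on rationals by the machine and on reals by the gale. The maximum with
    0 corresponds to truncated subtraction of numerators. *)
Definition lift_step (g : seq bool -> K) (x : seq bool * K) (a : trit) : seq bool * K :=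
  (rcons x.1 (a == Some true),
   match a with
   | None => 3 / 2 * x.2
   | Some true => g (rcons x.1 true)
   | Some false => Num.max 0 (3 / 2 * x.2 - g (rcons x.1 true))
   end).

Definition pair_lift (g : seq bool -> K) (c : K) (w : seq trit) : K :=
  (foldl (lift_step g) ([::], c) w).2.

End Lift.

(** * A program evaluating the lift with fractions of natural numbers *)

Section Program.
Variables (M : machine) (inp outp : option bool -> sym M).
Hypotheses (detM : deterministic M) (outp_inj : injective outp).
Variables (dhat : seq bool * nat -> rat) (bound : nat -> nat).
Hypothesis bound_homo : {homo bound : m n / m <= n}.
Hypothesis dhat_run : forall x,
  runs_within (map inp (enc_unary x)) (bound (size (enc_unary x))) /\
  exists2 v, outputs (map inp (enc_unary x)) (map outp v) & rat_of_word v = dhat x.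

Notation G := (stack_sym M (option trit)).
Notation bit := (@bit M).
Notation isone := (@isone M).
(* [P] and [Q] hold the numerator and the denominator of the current value, [p]
   and [q] those of an answer, [U] the current word of bits with its last symbol
   on top, and [RR] the precision in unary. *)
Notation name := (stack_name M 'I_13).
Notation machine := (smach name G).
Notation reg k := (inl (@Ordinal 13 k isT) : name).
Notation IN := (reg 0).
Notation OUT := (reg 1).
Notation RR := (reg 2).
Notation U := (reg 3).
Notation P := (reg 4).
Notation Q := (reg 5).
Notation p := (reg 6).
Notation q := (reg 7).
Notation T := (reg 8).
Notation S := (reg 9).
Notation X := (reg 10).
Notation Z := (reg 11).
Notation F := (reg 12).
Notation value := (nat_of_stack isone).

(** A concrete list of registers lets updates reduce by computation instead of by comparing
    names. *)
Definition regs (l : seq (seq G)) : store name G :=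
  tape_stacks (fun j : 'I_13 => nth [::] l j) (@blank M).

Lemma upd_regs l (j : 'I_13) x : upd (regs l) (inl j) x = regs (set_nth [::] l j x).
Proof.
rewrite /regs upd_stacks; congr tape_stacks; apply/funext => k.
by rewrite /upd nth_set_nth.
Qed.

Lemma regs_push l (j : 'I_13) a :
  does (pushm (inl j : name) a) (regs l) 1 (regs (set_nth [::] l j (a :: nth [::] l j))).
Proof. by rewrite -upd_regs; exact: does_push. Qed.

Lemma regs_clear l (j : 'I_13) :
  does (clear G (inl j : name)) (regs l) (size (nth [::] l j)).+1 (regs (set_nth [::] l j [::])).
Proof. by rewrite -upd_regs; exact: does_clear. Qed.

Lemma regs_move l (i j : 'I_13) : (inl i : name) != inl j ->
  does (move_to G (inl i : name) (inl j)) (regs l) (size (nth [::] l i)).+1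
    (regs (set_nth [::] (set_nth [::] l i [::]) j (catrev (nth [::] l i) (nth [::] l j)))).
Proof. by move=> nij; rewrite -!upd_regs; exact: does_move. Qed.

(** Multiplication by 3/2: two digits 1 on [p] form the factor 3 for [P], and a 0 pushed on [Q]
    doubles the denominator. *)
Definition scalem : machine :=
  seqm (pushm p (bit true)) (seqm (pushm p (bit true))
  (seqm (mulbym bit isone T S X Z p P) (seqm (clear G p) (pushm Q (bit false))))).

Definition querym : machine :=
  callm inp outp (@Ordinal 13 2 isT) (@Ordinal 13 3 isT) (@Ordinal 13 6 isT)
    (@Ordinal 13 7 isT) (@Ordinal 13 8 isT) (@Ordinal 13 12 isT).

Definition main_regs rest r u lP lQ lp lq : seq (seq G) :=
  [:: rest; [::]; r; u; lP; lQ; lp; lq; [::]; [::]; [::]; [::]; [::]].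

Lemma does_scale rest r u lP lQ :
  exists lP', [/\ does scalem (regs (main_regs rest r u lP lQ [::] [::]))
      (18 * size lP + 90) (regs (main_regs rest r u lP' (bit false :: lQ) [::] [::])),
    value lP' = 3 * value lP & size lP' <= size lP + 4].
Proof.
have run1 := regs_push (main_regs rest r u lP lQ [::] [::]) (@Ordinal 13 6 isT) (bit true).
have run2 := regs_push (main_regs rest r u lP lQ [:: bit true] [::]) (@Ordinal 13 6 isT) (bit true).
set l2 := set_nth _ _ _ _ in run2.
have [|||||||l [run3 valuel szl]] :=
  @does_mulby name G bit isone (@isone_bit M) T S X Z _ p P (regs l2) => //.
have three : value (regs l2 p) = 3.
  by rewrite -[LHS]/(isone (bit true) + (isone (bit true) + 0).*2) isone_bit.
exists l; split; [|by rewrite valuel three|by move: szl; rewrite /=].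
rewrite upd_regs in run3.
have run4 := regs_clear (main_regs rest r u l lQ [:: bit true; bit true] [::]) (@Ordinal 13 6 isT).
have run5 := regs_push (main_regs rest r u l lQ [::] [::]) (@Ordinal 13 5 isT) (bit false).
apply: does_le (does_seq run1 (does_seq run2 (does_seq run3 (does_seq run4 run5)))).
rewrite /=; clear; lia.
Qed.

(** P/Q - p/q = (Pq - pQ)/(Qq), without reduction; [Z] holds pQ. *)
Definition subtractm : machine :=
  seqm (mulbym bit isone T S X Z q P) (seqm (mulm bit isone T S X Z p Q)
  (seqm (subm bit isone T S Z P) (seqm (clear G Z) (seqm (mulbym bit isone T S X Z q Q)
  (seqm (clear G p) (clear G q)))))).

Lemma does_subtract rest r u lP lQ lp lq D :
  size lP <= D -> size lQ <= D -> size lp <= D -> size lq <= D ->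
  exists lP' lQ', [/\ does subtractm (regs (main_regs rest r u lP lQ lp lq))
      (50 * D ^ 2 + 100 * D + 50) (regs (main_regs rest r u lP' lQ' [::] [::])),
    value lP' = value lP * value lq - value lp * value lQ,
    value lQ' = value lQ * value lq &
    size lP' <= maxn (size lP) (size lQ) + (maxn (size lp) (size lq)).*2 /\
    size lQ' <= size lQ + (size lq).*2].
Proof.
move=> szP szQ szp szq.
have [|||||||lA [run1 valA szA]] := @does_mulby name G bit isone (@isone_bit M) T S X Z _ q P
  (regs (main_regs rest r u lP lQ lp lq)) => //.
rewrite upd_regs /= in run1.
have {}szA : size lA <= size lP + (size lq).*2 by [].
have {}valA : value lA = value lq * value lP by [].
have [|||||||lB [run2 valB szB]] := @does_mul name G bit isone (@isone_bit M) T S X Z _ p Q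
  (regs (main_regs rest r u lA lQ lp lq)) => //.
rewrite upd_regs /= in run2.
have {}szB : size lB <= size lQ + (size lp).*2 by [].
have {}valB : value lB = value lp * value lQ by [].
have [||||||lC [run3 valC szC]] := @does_sub name G bit isone (@isone_bit M) T S X Z _ Z P
  (regs [:: rest; [::]; r; u; lA; lQ; lp; lq; [::]; [::]; [::]; lB; [::]]) => //.
rewrite upd_regs /= in run3.
have {}szC : size lC <= maxn (size lB) (size lA) by [].
have {}valC : value lC = value lA - value lB by [].
pose l4 := [:: rest; [::]; r; u; lC; lQ; lp; lq; [::]; [::]; [::]; lB; [::]].
have run4 := regs_clear l4 (@Ordinal 13 11 isT).
have [|||||||lE [run5 valE szE]] := @does_mulby name G bit isone (@isone_bit M) T S X Z _ q Q
  (regs (main_regs rest r u lC lQ lp lq)) => //.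
rewrite upd_regs /= in run5.
have {}szE : size lE <= size lQ + (size lq).*2 by [].
have {}valE : value lE = value lq * value lQ by [].
have run6 := regs_clear (main_regs rest r u lC lE lp lq) (@Ordinal 13 6 isT).
have run7 := regs_clear (main_regs rest r u lC lE [::] lq) (@Ordinal 13 7 isT).
exists lC, lE; split.
- apply: does_le (does_seq run1 (does_seq run2 (does_seq run3 (does_seq run4
    (does_seq run5 (does_seq run6 run7)))))).
  have mul_le x y : x <= D -> y <= D -> x.+1 * (6 * y + 6 * x + 12) <= (D.+1) * (12 * D + 12).
    by move=> xD yD; apply: leq_mul; clear - xD yD; lia.
  have H1 := mul_le _ _ szq szP; have H2 := mul_le _ _ szp szQ; have H3 := mul_le _ _ szq szQ.
  rewrite /= -mulnn; move: szA szB szC szE szP szQ szp szq H1 H2 H3.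
  rewrite /=; clear; lia.
- by rewrite valC valA valB mulnC.
- by rewrite valE mulnC.
- by move: szA szB szC szE; clear; lia.
Qed.

Notation u_regs := (fun u : seq bool => map bit (rev u)).

Lemma does_call_regs rest r (u : seq bool) lP lQ :
  let N := (size u + size r).+1 in
  let B := N + 2 * bound N + 2 in
  exists lp lq, [/\ does querym (regs (main_regs rest r (u_regs u) lP lQ [::] [::])) (10 * B)
      (regs (main_regs rest r (u_regs u) lP lQ lp lq)),
    0 < value lq,
    ((value lp)%:R / (value lq)%:R = Num.max 0 (dhat (rcons u true, size r)))%R,
    size lp <= B & size lq <= B].
Proof.
move=> N B; have [within [v [n [c [sts hc out]]] <-]] := dhat_run (rcons u true, size r).
have szN : size (enc_unary (rcons u true, size r)) = N.
  by rewrite /enc_unary size_cat size_map size_rcons size_nseq.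
have n_le : n <= bound N by rewrite -szN; exact: within sts.
pose e (j : 'I_13) := nth [::] (main_regs rest r (u_regs u) lP lQ [::] [::]) j.
have [||||||lp [lq [run pos val szp szq]]] := @does_call M 'I_13 detM inp outp outp_inj
  (@Ordinal 13 2 isT) (@Ordinal 13 3 isT) (@Ordinal 13 6 isT)
  (@Ordinal 13 7 isT) (@Ordinal 13 8 isT) (@Ordinal 13 12 isT) _ e u n c v _ _ _ _ _ sts hc out.
all: try by [].
have B_le : size r + size u + 2 * n + 3 <= B.
  by move: n_le; rewrite /B; move: (bound N); rewrite /N; clear; lia.
exists lp, lq; split=> //; [|exact: leq_trans szp B_le|exact: leq_trans szq B_le].
rewrite -!upd_stacks in run.
apply: (does_le (t := 10 * (size r + size u + 2 * n + 3))); first by rewrite leq_mul2l.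
by move: run; rewrite -/(regs _) !upd_regs.
Qed.

(** Over a common positive denominator, the numerator is cut at 0 exactly when the difference is
    negative. *)
Lemma natr_truncated_sub (K : realFieldType) (a b c d : nat) : 0 < c -> 0 < d ->
  (((a * d - b * c)%N%:R / (c * d)%N%:R : K) = Num.max 0 (a%:R / c%:R - b%:R / d%:R))%R.
Proof.
move=> c0 d0.
have [cR dR] : (0 < c%:R :> K)%R /\ (0 < d%:R :> K)%R by rewrite !ltr0n.
have -> : (a%:R / c%:R - b%:R / d%:R = (a%:R * d%:R - b%:R * c%:R) / (c%:R * d%:R) :> K)%R.
  rewrite mulrBl -mulf_div divff ?gt_eqF // mulr1; congr (_ - _)%R.
  by rewrite [(c%:R * d%:R)%R]mulrC -mulf_div divff ?gt_eqF // mulr1.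
rewrite !natrM; case: (leqP (b * c) (a * d)) => [le|/ltnW le].
  rewrite natrB // !natrM; apply/esym/max_idPr/divr_ge0; last by rewrite mulr_ge0.
  by rewrite subr_ge0 -!natrM ler_nat.
rewrite (eqP le) mul0r; apply/esym/max_idPl; rewrite pmulr_lle0.
  by rewrite subr_le0 -!natrM ler_nat.
by rewrite invr_gt0 mulr_gt0.
Qed.

Definition move2m (i j : name) : machine := seqm (move_to G i T) (move_to G T j).

Definition letterm (a : trit) : machine :=
  match a with
  | None => seqm scalem (pushm U (bit false))
  | Some true => seqm querym (seqm (clear G P) (seqm (clear G Q)
      (seqm (move2m p P) (seqm (move2m q Q) (pushm U (bit true))))))
  | Some false => seqm scalem (seqm querym (seqm subtractm (pushm U (bit false))))
  end.

(** The lengths grow by an amount independent of [C]: scaling adds a constant and subtracting adds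
    twice the length of the answer. Over all letters the growth is therefore additive. *)
Lemma does_letter a rest r (u : seq bool) lP lQ C B :
  let g v := Num.max 0%R (dhat (v, size r)) in
  let N := (size u + size r).+1 in
  N + 2 * bound N + 2 <= B -> size lP <= C -> size lQ <= C -> 0 < value lQ ->
  exists lP' lQ', [/\
    does (letterm a) (regs (main_regs rest r (u_regs u) lP lQ [::] [::]))
      (100 * (C + 2 * B + 6) ^ 2 + 1000 * (C + 2 * B + 6) + 200)
      (regs (main_regs rest r (u_regs (rcons u (a == Some true))) lP' lQ' [::] [::])),
    0 < value lQ',
    ((value lP')%:R / (value lQ')%:R =
      (lift_step g (u, (value lP)%:R / (value lQ)%:R) a).2)%R &
    size lP' <= C + 2 * B + 6 /\ size lQ' <= C + 2 * B + 6].
Proof.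
move=> g N N_le szP szQ posQ.
have pushU b l1 l2 : does (pushm U (bit b)) (regs (main_regs rest r (u_regs u) l1 l2 [::] [::])) 1
    (regs (main_regs rest r (u_regs (rcons u b)) l1 l2 [::] [::])).
  by have := regs_push (main_regs rest r (u_regs u) l1 l2 [::] [::]) (@Ordinal 13 3 isT) (bit b);
    rewrite /= rev_rcons.
have value0 l : value (bit false :: l) = 2 * value l.
  by rewrite mul2n -[LHS]/(isone (bit false) + (value l).*2) isone_bit.
have scaled lP' : value lP' = 3 * value lP ->
    ((value lP')%:R / (value (bit false :: lQ))%:R =
     3 / 2 * ((value lP)%:R / (value lQ)%:R) :> rat)%R.
  by move=> ->; rewrite value0 !natrM mulf_div.
set D := C + 2 * B + 6.
case: a => [[]|].
- have [lp [lq [run1 pos val szp szq]]] := does_call_regs rest r u lP lQ.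
  have run2 := regs_clear (main_regs rest r (u_regs u) lP lQ lp lq) (@Ordinal 13 4 isT).
  have run3 := regs_clear (main_regs rest r (u_regs u) [::] lQ lp lq) (@Ordinal 13 5 isT).
  have run4 := @regs_move (main_regs rest r (u_regs u) [::] [::] lp lq)
    (@Ordinal 13 6 isT) (@Ordinal 13 8 isT) isT.
  have run5 := @regs_move [:: rest; [::]; r; u_regs u; [::]; [::]; [::]; lq; rev lp;
    [::]; [::]; [::]; [::]] (@Ordinal 13 8 isT) (@Ordinal 13 4 isT) isT.
  rewrite /= -[catrev (rev lp) _]/(rev _) revK in run5.
  have run6 := @regs_move (main_regs rest r (u_regs u) lp [::] [::] lq)
    (@Ordinal 13 7 isT) (@Ordinal 13 8 isT) isT.
  have run7 := @regs_move [:: rest; [::]; r; u_regs u; lp; [::]; [::]; [::]; rev lq;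
    [::]; [::]; [::]; [::]] (@Ordinal 13 8 isT) (@Ordinal 13 5 isT) isT.
  rewrite /= -[catrev (rev lq) _]/(rev _) revK in run7.
  exists lp, lq; split=> //; last by move: szp szq N_le; rewrite -/N /D; clear; lia.
  apply: does_le (does_seq run1 (does_seq run2 (does_seq run3 (does_seq
    (does_seq run4 run5) (does_seq (does_seq run6 run7) (pushU true _ _)))))).
  move: szp szq N_le szP szQ; rewrite /= !size_rev -/N /D.
  by move: (size lp) (size lq) (size lP) (size lQ); move: (_ ^ 2); clear; lia.
- have [lP1 [run1 val1 sz1]] := does_scale rest r (u_regs u) lP lQ.
  have [lp [lq [run2 pos val szp szq]]] := does_call_regs rest r u lP1 (bit false :: lQ).
  have [||||lP2 [lQ2 [run3 valP valQ [szP2 szQ2]]]] := @does_subtract rest r (u_regs u)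
    lP1 (bit false :: lQ) lp lq D.
  - by move: sz1 szP; rewrite /D; clear; lia.
  - by move: szQ; rewrite /D /=; clear; lia.
  - by move: szp N_le; rewrite -/N /D; clear; lia.
  - by move: szq N_le; rewrite -/N /D; clear; lia.
  exists lP2, lQ2; split.
  - apply: does_le (does_seq run1 (does_seq run2 (does_seq run3 (pushU false _ _)))).
    move: sz1 N_le szP szQ; rewrite -/N /D.
    by move: (_ ^ 2); clear; lia.
  - by rewrite valQ muln_gt0 pos value0 muln_gt0 posQ.
  - rewrite valP valQ natr_truncated_sub //; last by rewrite value0 muln_gt0.
    by rewrite scaled // val.
  - move: szP2 szQ2 sz1 szp szq N_le szP szQ; rewrite -/N /D /=.
    by clear; lia.
- have [lP1 [run1 val1 sz1]] := does_scale rest r (u_regs u) lP lQ.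
  exists lP1, (bit false :: lQ); split.
  - apply: does_le (does_seq run1 (pushU false _ _)).
    by move: szP; rewrite /D; move: (_ ^ 2); clear; lia.
  - by rewrite value0 muln_gt0.
  - exact: scaled.
  - by move: sz1 szP szQ; rewrite /D /=; clear; lia.
Qed.

Notation letter := (fun a : trit => inr (Some a) : G).

Definition lettersm : machine :=
  loopm IN (fun g : G => if g is inr (Some a) then letterm a else clear G T).

Lemma does_letters (w : seq trit) r (u : seq bool) lP lQ C B :
  let g v := Num.max 0%R (dhat (v, size r)) in
  let N := size u + size w + size r in
  let D := C + size w * (2 * B + 6) in
  let x := foldl (lift_step g) (u, (value lP)%:R / (value lQ)%:R)%R w in
  N + 2 * bound N + 2 <= B -> size lP <= C -> size lQ <= C -> 0 < value lQ ->
  exists lP' lQ', [/\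
    does lettersm (regs (main_regs (map letter w) r (u_regs u) lP lQ [::] [::]))
      (size w * (100 * D ^ 2 + 1000 * D + 201) + 1)
      (regs (main_regs [::] r (u_regs x.1) lP' lQ' [::] [::])),
    0 < value lQ', ((value lP')%:R / (value lQ')%:R = x.2)%R &
    size lP' <= D /\ size lQ' <= D].
Proof.
move=> g; elim: w u lP lQ C => [|a w IH] u lP lQ C N D x N_le szP szQ posQ.
  exists lP, lQ; split=> //; last by rewrite /D mul0n addn0.
  by apply: does_le (does_loop0 _ _).
(* The projected word never exceeds the initial [u] plus the remaining letters, so by monotonicity a
   single [B] covers all queries. *)
have N1 : (size u + size r).+1 + 2 * bound (size u + size r).+1 + 2 <= B.
  apply: leq_trans N_le; rewrite leq_add2r; apply: leq_add.
    by rewrite /N /=; clear; lia.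
  by rewrite leq_mul2l /=; apply: bound_homo; rewrite /N /=; clear; lia.
have [lP1 [lQ1 [run1 posQ1 val1 [szP1 szQ1]]]] :=
  does_letter a (map letter w) N1 szP szQ posQ.
have [||||lP2 [lQ2 [run2 posQ2 val2 [szP2 szQ2]]]] :=
  IH (rcons u (a == Some true)) lP1 lQ1 (C + 2 * B + 6) => //.
  by rewrite size_rcons addSnnS.
have DE : C + 2 * B + 6 + size w * (2 * B + 6) = D.
  by rewrite /D /= mulSn; clear; lia.
have xE : foldl (lift_step g)
    (rcons u (a == Some true), (value lP1)%:R / (value lQ1)%:R)%R w = x.
  by rewrite /x /= val1.
rewrite DE xE in run2 val2 szP2 szQ2.
exists lP2, lQ2; split=> //.
have IN_cons : regs (main_regs (map letter (a :: w)) r (u_regs u) lP lQ [::] [::]) IN =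
  letter a :: map letter w by [].
have := does_loopS IN_cons _ run2; rewrite upd_regs => /(_ _ run1).
apply: does_le; rewrite [size (a :: w)]/= [(size w).+1 * _]mulSn.
have : C + 2 * B + 6 <= D by rewrite -DE leq_addr.
move: (C + 2 * B + 6) => D'; move: (size w * _) => K D'_le.
have : D' ^ 2 <= D ^ 2 by rewrite leq_sqr.
by move: D'_le; move: (D' ^ 2) (D ^ 2); clear; lia.
Qed.

Variable m : nat.

(** The initial value of [D] only has to be large; a power of two is written by pushing zeros on a
    1, with [m] fixed in the machine. *)
Fixpoint power2m k : machine :=
  if k is k'.+1 then seqm (power2m k') (pushm P (bit false)) else pushm P (bit true).

Lemma does_power2 k rest r u :
  exists lP, [/\ does (power2m k) (regs (main_regs rest r u [::] [::] [::] [::])) k.+1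
      (regs (main_regs rest r u lP [::] [::] [::])), value lP = 2 ^ k & size lP = k.+1].
Proof.
elim: k => [|k [lP [run val sz]]].
  exists [:: bit true]; split; [| |by []]; last first.
    by rewrite -[LHS]/(isone (bit true) + 0) isone_bit.
  exact: (regs_push (main_regs rest r u [::] [::] [::] [::]) (@Ordinal 13 4 isT) (bit true)).
exists (bit false :: lP); split; last by rewrite /= sz.
  apply: (does_le (t := k.+1 + 1)); first by rewrite addn1.
  apply: does_seq run _.
  exact: (regs_push (main_regs rest r u lP [::] [::] [::]) (@Ordinal 13 4 isT) (bit false)).
by rewrite expnS -val mul2n -[LHS]/(isone (bit false) + (value lP).*2) isone_bit.
Qed.

Definition is_letter (g : G) : bool := if g is inr (Some _) then true else false.

Definition outbitsm (i : name) : machine :=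
  pourm i (fun g k => if k == OUT then Some (bit (isone g)) else None).

(** The whole input goes to [RR], whose length |w| + r becomes the query precision; the letters
    alone return to [IN] in their order. The output stack is filled from its end: denominator,
    separator, numerator, sign. *)
Definition programm : machine :=
  seqm (pourm IN (fun g k => if k == RR then Some g
    else if (k == S) && is_letter g then Some g else None))
  (seqm (move_to G S IN)
  (seqm (power2m m)
  (seqm (pushm Q (bit true))
  (seqm lettersm
  (seqm (outbitsm Q)
  (seqm (pushm OUT (inr (Some None)))
  (seqm (outbitsm P) (pushm OUT (bit false))))))))).

Lemma regs_outbits l (i : 'I_13) : (inl i : name) != OUT ->
  does (outbitsm (inl i)) (regs l) (size (nth [::] l i)).+1
    (regs (set_nth [::] (set_nth [::] l i [::]) 1
      (catrev (map (bit \o isone) (nth [::] l i)) (nth [::] l 1)))).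
Proof.
move=> nij; have := does_pour (inl i : name)
  (fun g k => if k == OUT then Some (bit (isone g)) else None) (regs l).
rewrite -[regs (set_nth _ _ 1 _)](upd_regs _ (@Ordinal 13 1 isT)) -upd_regs.
congr does; apply/funext => k; rewrite /upd.
case: (eqVneq k (inl i)) => [->|_]; first by rewrite (negPf nij).
case: (eqVneq k OUT) => [->|_]; last by elim: (regs l _).
by congr catrev; elim: (regs l _) => //= a s ->.
Qed.

Lemma value_bits l : nat_of_bits (map isone (rev l)) = value l.
Proof.
elim: l => // a l IH.
by rewrite rev_cons map_rcons /nat_of_bits -cats1 foldl_cat /= -/(nat_of_bits _) IH addnC.
Qed.

(** A query has at most |w| bits and a precision part of length [N], hence the bound [2 * N] on its
    length. *)
Lemma does_program (w : seq trit) r :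
  let N := size (enc_unary (w, r)) in
  let g v := Num.max 0%R (dhat (v, N)) in
  let B := 2 * N + 2 * bound (2 * N) + 2 in
  let D := m + 1 + N * (2 * B + 6) in
  exists s v, [/\ does programm (fun i => if i == IN then map inr (enc_unary (w, r)) else [::])
      (N.+1 * (100 * D ^ 2 + 1000 * D + 300)) s,
    s OUT = map (fun o => inr (Some o)) v & rat_of_word v = pair_lift g (2 ^ m)%:R%R w].
Proof.
move=> N g B D.
set input := map _ (enc_unary _).
have szinput : size input = N by rewrite size_map.
have szwN : size w <= N by rewrite /N /enc_unary size_cat size_map leq_addr.
have letters : pmap (fun a : G => if is_letter a then Some a else None) input = map letter w.
  rewrite /input /enc_unary /=; elim: w {input N g B D szinput szwN} => [|a w /= -> //].
  by elim: r.
set s0 := fun i : name => _.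
have run1 : does (pourm IN (fun g k => if k == RR then Some g
    else if (k == S) && is_letter g then Some g else None)) s0 N.+1
    (regs [:: [::]; [::]; rev input; [::]; [::]; [::]; [::]; [::]; [::];
              rev (map letter w); [::]; [::]; [::]]).
  have := does_pour IN (fun g k => if k == RR then Some g
    else if (k == S) && is_letter g then Some g else None) s0.
  have -> : s0 IN = input by [].
  rewrite szinput; congr does; apply/funext => k.
  have pmap_none : pmap (fun=> @None G) input = [::] by elim: (input).
  have pmap_some : pmap (fun a : G => Some a) input = input by elim: (input) => //= a l ->.
  case: k => [[k k13]|[j b]]; last by rewrite /regs /s0 /= pmap_none; case: b.
  do 13 (case: k k13 => [|k] k13; first
    by rewrite /regs /s0 /= ?pmap_none ?pmap_some ?letters).
  by [].
have run2 := @regs_move [:: [::]; [::]; rev input; [::]; [::]; [::]; [::]; [::]; [::];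
  rev (map letter w); [::]; [::]; [::]] (@Ordinal 13 9 isT) (@Ordinal 13 0 isT) isT.
rewrite /= -[catrev (rev _) _]/(rev _) revK size_rev size_map in run2.
have [lP [run3 valP szP]] := does_power2 m (map letter w) (rev input) [::].
have run4 := regs_push (main_regs (map letter w) (rev input) [::] lP [::] [::] [::])
  (@Ordinal 13 5 isT) (bit true).
have value1 : value [:: bit true] = 1.
  by rewrite -[LHS]/(isone (bit true) + 0) isone_bit.
have [||||lP1 [lQ1 [run5 posQ val [szP1 szQ1]]]] :=
  @does_letters w (rev input) [::] lP [:: bit true] (m + 1) B.
- rewrite /= add0n size_rev szinput /B leq_add2r; apply: leq_add.
    by rewrite mul2n -addnn leq_add2r.
  by rewrite leq_mul2l /=; apply: bound_homo; rewrite mul2n -addnn leq_add2r.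
- by rewrite szP addn1.
- by rewrite /= addn1.
- by rewrite value1.
rewrite size_rev szinput value1 divr1 valP in val run5.
set u1 := (X in main_regs _ _ X lP1) in run5.
have run6 := @regs_outbits (main_regs [::] (rev input) u1 lP1 lQ1 [::] [::])
  (@Ordinal 13 5 isT) isT.
pose l7 (oo lP : seq G) : seq (seq G) :=
  [:: [::]; oo; rev input; u1; lP; [::]; [::]; [::]; [::]; [::]; [::]; [::]; [::]].
have run7 := regs_push (l7 (catrev (map (bit \o isone) lQ1) [::]) lP1) (@Ordinal 13 1 isT)
  (inr (Some None)).
have run8 := @regs_outbits (l7 (inr (Some None) :: catrev (map (bit \o isone) lQ1) [::]) lP1)
  (@Ordinal 13 4 isT) isT.
have run9 := regs_push (l7 (catrev (map (bit \o isone) lP1)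
  (inr (Some None) :: catrev (map (bit \o isone) lQ1) [::])) [::]) (@Ordinal 13 1 isT) (bit false).
exists (regs (l7 (bit false :: catrev (map (bit \o isone) lP1)
  (inr (Some None) :: catrev (map (bit \o isone) lQ1) [::])) [::])).
exists (Some false :: map Some (map isone (rev lP1)) ++ None :: map Some (map isone (rev lQ1))).
split.
- apply: does_le (does_seq run1 (does_seq run2 (does_seq run3 (does_seq run4 (does_seq run5
    (does_seq run6 (does_seq run7 (does_seq run8 run9)))))))).
  have D'_le : m + 1 + size w * (2 * B + 6) <= D by rewrite /D leq_add2l leq_mul2r szwN orbT.
  move: szP1 szQ1 D'_le.
  rewrite [nth _ _ _]/=; move: (m + 1 + size w * _) => D' szP1 szQ1 D'_le.
  have mD : m < D by rewrite /D -addn1 leq_addr.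
  have sq : D' ^ 2 <= D ^ 2 by rewrite leq_sqr.
  have prod : size w * (100 * D' ^ 2 + 1000 * D' + 201) <= N * (100 * D ^ 2 + 1000 * D + 201).
    by apply: leq_mul => //; move: D'_le sq; move: (D ^ 2) (D' ^ 2); clear; lia.
  move: prod szP1 szQ1 mD D'_le szwN; rewrite [N.+1 * _]mulSn; clearbody D; clear.
  move: (_ * _) => K1; move: (D ^ 2) => D2; clearbody N.
  rewrite -[nth _ (l7 _ _) _]/lP1; move: (size lP1) (size lQ1) (size w).
  by clear; lia.
- rewrite /= !catrevE map_cat /= cats0 -!map_rev -!map_comp.
  by [].
rewrite /rat_of_word.
have -> : index None (Some false :: map Some (map isone (rev lP1)) ++
    None :: map Some (map isone (rev lQ1))) = (size lP1).+1.
  rewrite /= index_cat; case: ifP => [/mapP[]//|_].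
  by rewrite !size_map size_rev /= addn0.
rewrite /pair_lift; move: val; rewrite -/g => <-.
have szs : size (map Some (map isone (rev lP1))) = size lP1 by rewrite !size_map size_rev.
rewrite /= take_size_cat // drop_size_cat //=.
have pmap_someK (l : seq bool) : pmap id (map Some l) = l by elim: l => //= a l ->.
by rewrite !pmap_someK !value_bits expr0 mul1r.
Qed.

End Program.

(** * Quasipolynomial running time *)

Lemma leq_expl a b n : a <= b -> a ^ n <= b ^ n.
Proof. by case: n => // n ab; rewrite leq_exp2r. Qed.

(** For L at least 2, L + 1 is at most L^2 and a at most L^a, so the product is absorbed by the
    power; the additive term handles L = 0 and L = 1. *)
Lemma trunc_poly_bound (a b j : nat) :
  exists k, forall L, a * L.+1 ^ j + b <= L ^ k + k.
Proof.
exists (a + 2 * j + (a * 2 ^ j + b)) => L.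
have [L1|L2] := leqP L 1.
  apply: leq_trans (leq_addl _ _); apply: leq_trans (leq_addl _ _).
  by rewrite leq_add2r leq_mul2l; apply/orP; right; apply: leq_expl.
set k := a + _ + _.
have le1 : L.+1 ^ j <= L ^ (2 * j).
  by rewrite expnM; apply: leq_expl; rewrite expnS expn1; nia.
have le2 : a <= L ^ a by apply: ltnW; apply: ltn_expl.
apply: leq_add.
  apply: leq_trans (leq_mul le2 le1) _; rewrite -expnD.
  by rewrite leq_exp2l // /k leq_addr.
by rewrite /k; lia.
Qed.

(** All quantities are at most powers of two whose exponents are polynomial in the logarithm L, and
    products merely add exponents. The leading factor 2 pays for the compilation to Turing
    machines. *)
Lemma qp_time_bound (m k : nat) :
  let bound n := 2 ^ (trunc_log 2 n ^ k + k) in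
  exists k', forall N,
    let B := 2 * N + 2 * bound (2 * N) + 2 in
    let D := m + 1 + N * (2 * B + 6) in
    is_true (2 * (N.+1 * (100 * D ^ 2 + 1000 * D + 300)) <= 2 ^ (trunc_log 2 N ^ k' + k')).
Proof.
move=> bound.
(* The total exponent below is 5E + 2m + 22, and E is at most 2(L+1)^(k+1) + k. *)
have [k' k'P] := trunc_poly_bound 10 (5 * k + 2 * m + 30) k.+1.
exists k' => N B D; set L := trunc_log 2 N.
have [E EE] : exists E, E = L.+1 ^ k + k + L.+1 by eexists.
have NE : N.+1 <= 2 ^ E.
  apply: leq_trans (trunc_log_ltn N (isT : 1 < 2)) _.
  by rewrite leq_exp2l // EE leq_addl.
have bE : bound (2 * N) <= 2 ^ E.
  rewrite /bound leq_exp2l // EE; apply: leq_trans (leq_addr _ _).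
  rewrite leq_add2r; apply: leq_expl; case: (posnP N) => [->|N0].
    by rewrite muln0 trunc_log0.
  by rewrite mul2n trunc_log2_double.
have mE : m < 2 ^ m by apply: ltn_expl.
have m0 : 0 < 2 ^ m by rewrite expn_gt0.
have E0 : 0 < 2 ^ E by rewrite expn_gt0.
have [A AE] : exists A, A = m + E + E + 5 by eexists.
have DA : D <= 2 ^ A.
  rewrite AE !expnD -[2 ^ 5]/(32) /D /B.
  move: NE bE mE m0 E0; move: (bound _) (2 ^ E) (2 ^ m) => b e f.
  clear => NE bE mE m0 E0.
  have H1 : N * (2 * (2 * N + 2 * b + 2) + 6) <= e * (18 * e).
    by apply: leq_mul; lia.
  have H2 : e * e <= f * e * e by rewrite -mulnA leq_pmull.
  have H3 : f <= f * e * e by rewrite -mulnA leq_pmulr // muln_gt0 E0.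
  by lia.
have A0 : 0 < 2 ^ A by rewrite expn_gt0.
apply: leq_trans (leq_pexp2l (isT : 0 < 2) (k'P L)).
apply: leq_trans (_ : 2 ^ (E + A + A + 12) <= _).
  rewrite !expnD -[2 ^ 12]/(4096).
  move: NE DA A0 E0; move: (2 ^ E) (2 ^ A) => e d; rewrite -mulnn; clear => NE DA A0 E0.
  have H1 : D * D <= d * d by apply: leq_mul.
  have H2 : d <= d * d by rewrite leq_pmull.
  have H3 : 100 * (D * D) + 1000 * D + 300 <= 2000 * (d * d) by lia.
  have := leq_mul NE H3.
  rewrite [e * (2000 * _)]mulnCA -[e * d * d]mulnA.
  by move: (N.+1 * _) (e * _) => x y; clear; lia.
rewrite leq_exp2l // AE EE.
have L0 : 0 < L.+1 ^ k by rewrite expn_gt0.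
have H1 : L.+1 ^ k <= L.+1 ^ k * L.+1 by rewrite leq_pmulr.
have H2 : L.+1 <= L.+1 ^ k * L.+1 by rewrite leq_pmull.
rewrite expnSr; move: H1 H2; move: (L.+1 ^ k) => x; clear; lia.
Qed.

Lemma qp_lift (dhat : seq bool * nat -> rat) (m : nat) :
  qp (@enc_unary bool) rat_of_word dhat ->
  qp (@enc_unary trit) rat_of_word (fun x =>
    pair_lift (fun v => Num.max 0%R (dhat (v, size (enc_unary x)))) (2 ^ m)%:R%R x.1).
Proof.
move=> [M [inp [outp [k [detM inp_inj outp_inj run]]]]].
pose bound n := 2 ^ (trunc_log 2 n ^ k + k).
have bound_homo : {homo bound : a b / a <= b}.
  move=> a b ab; rewrite /bound leq_exp2l // leq_add2r.
  by apply: leq_expl; apply: leq_trunc_log.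
have [k' k'P] := qp_time_bound m k.
pose G := stack_sym M (option trit).
pose iIN : stack_name M 'I_13 := inl (@Ordinal 13 0 isT).
pose iOUT : stack_name M 'I_13 := inl (@Ordinal 13 1 isT).
have nio : iIN != iOUT by [].
exists (tm_of iIN iOUT (programm inp outp m)).
exists (inr : option trit -> G), (fun o => inr (Some o) : G), k'.
split; [exact: tm_of_deterministic | by move=> ? ? [] | by move=> ? ? [] |].
move=> [w r]; have := does_program detM outp_inj bound_homo run m w r.
move=> [s [v [[n n_le runs_n] outE vE]]].
have [within outs] := tm_of_computes nio runs_n outE.
split; last by exists v.
move=> i c st; apply: leq_trans (within i c st) _.
by apply: leq_trans (k'P _); rewrite -mul2n leq_mul2l n_le.
Qed.

(** * The lifted gale on pairs *)

Section Gales.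
Variable R : realType.
Local Open Scope ring_scope.

(** Intermediate values: the sum is 2 at t = 0 and 5/8 at t = 1, and 5/8 differs from 2/3, so t = 1
    is excluded. *)
Lemma exists_dimension :
  exists2 t : R, 0 <= t < 1 & (3 / 8) `^ t + (1 / 4) `^ t = 2 / 3.
Proof.
pose f (t : R) := expR (t * ln (3 / 8)) + expR (t * ln (1 / 4)).
have fE t : (3 / 8) `^ t + (1 / 4) `^ t = f t.
  by rewrite /powR !gt_eqF //; lra.
have f1 : f 1 = 5 / 8.
  by rewrite /f !mul1r !lnK ?posrE; lra.
have f0 : f 0 = 2 by rewrite /f !mul0r expR0; lra.
have cf : {within `[0, 1], continuous f}%classic.
  have ce (k : R) : continuous (fun t : R => expR (t * k)).
    move=> x; apply: (@continuous_comp _ _ _ (fun t : R => t * k) expR).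
      by apply: cvgM; [exact: cvg_id | exact: cvg_cst].
    exact: continuous_expR.
  by apply: continuous_subspaceT => x; apply: cvgD; exact: ce.
have [|t t01 ft] := @IVT R f 0 1 (2 / 3) ler01 cf.
  by rewrite f0 f1 ge_min le_max; apply/andP; split; apply/orP; [right|left]; lra.
exists t; last by rewrite fE.
move: t01; rewrite in_itv /= => /andP[-> t1] /=; rewrite lt_neqAle t1 andbT.
by apply/eqP => tE; move: ft; rewrite tE f1; lra.
Qed.

Lemma limn_esup_le_pinfty (u v : nat -> \bar R) :
  (forall n, u n <= v n)%E -> limn_esup u = +oo%E -> limn_esup v = +oo%E.
Proof.
move=> uv u_oo; apply/eqP; rewrite -leye_eq -u_oo !limn_esup_lim.
apply: lee_lim; [exact: is_cvg_esups|exact: is_cvg_esups|].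
near=> n; rewrite /esups /=; apply: ge_ereal_sup => _ [k nk <-].
by apply: le_trans (uv k) _; apply: ereal_sup_ubound; exists k.
Unshelve. all: by end_near.
Qed.

(** The projection of the overview on a single letter. *)
Definition first_lang (a : trit) : bool := a == Some true.

Lemma lift_prefix (K : realFieldType) (g : seq bool -> K) c w :
  (foldl (lift_step g) ([::], c) w).1 = map first_lang w.
Proof.
by elim/last_ind: w => // w a IH; rewrite -cats1 foldl_cat map_cat /= IH -cats1.
Qed.

Lemma lift_rcons (K : realFieldType) (g : seq bool -> K) c w a :
  pair_lift g c (rcons w a) = (lift_step g (map first_lang w, pair_lift g c w) a).2.
Proof.
by rewrite /pair_lift -cats1 foldl_cat /= -(lift_prefix g c); case: foldl.
Qed.

Lemma ratr_max (x y : rat) : ratr (Num.max x y) = Num.max (ratr x) (ratr y) :> R.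
Proof. by rewrite !maxEle ler_rat; case: ifP. Qed.

(** The recursion uses only rational constants, field operations and maxima, all preserved by
    [ratr]. *)
Lemma ratr_lift (g : seq bool -> rat) c w :
  ratr (pair_lift g c w) = pair_lift (ratr \o g) (ratr c) w :> R.
Proof.
elim/last_ind: w => // w a IH; rewrite !lift_rcons /=.
by case: a => [[]|] //; rewrite ?ratr_max ?rmorphB ?rmorph0 rmorphM /= IH
  rmorph_div ?unitfE //= !ratr_nat.
Qed.

(** The bound solves E' = 2E + e with E = 0 at the start. One letter multiplies the error by at most
    3/2, which 2 majorizes, and adds one query error; cutting at 0 does not enlarge differences. *)
Lemma lift_error (g h : seq bool -> R) c e w : 0 <= e ->
  (forall v, `|g v - h v| <= e) ->
  `|pair_lift g c w - pair_lift h c w| <= e * (2 ^+ size w - 1).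
Proof.
move=> e0 gh; elim/last_ind: w => [|w a IH].
  by rewrite /pair_lift /= subrr normr0 expr0 subrr mulr0.
rewrite !lift_rcons size_rcons exprS.
have p1 : 1 <= 2 ^+ size w :> R by rewrite exprn_ege1 // ler1n.
have ep : 0 <= e * (2 ^+ size w - 1) by rewrite mulr_ge0 // subr_ge0.
have -> : e * (2 * 2 ^+ size w - 1) = 2 * (e * (2 ^+ size w - 1)) + e.
  by rewrite !mulrBr mulrCA; lra.
move: ep IH; set z := e * _; case: a => [[]|] /= z0 IH.
- by apply: le_trans (gh _) _; lra.
- set v := rcons _ _; have := gh v; move: (g v) (h v) (pair_lift g c w) (pair_lift h c w) IH.
  move=> gv hv x y; rewrite !ler_norml => /andP[? ?] /andP[? ?].
  by rewrite !maxEle; case: ifP => /idP ?; case: ifP => /idP ?; apply/andP; split; lra.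
- move: (pair_lift g c w) (pair_lift h c w) IH => x y; rewrite !ler_norml => /andP[? ?].
  by apply/andP; split; lra.
Qed.

Section Lower.
Variables (d : seq bool -> R) (c : R).
Hypotheses (d_ge0 : forall v, 0 <= d v) (c_ge : d [::] <= c).
Hypothesis d_super : forall v, 2 / 3 * (d (rcons v true) + d (rcons v false)) <= d v.

(** After -1, the inductive bound and [d_super] give 3/2 D(w) - d(v1) at least d(v0), where v is the
    projected word; after 0 the value is larger still, and after 1 equality holds. The gale
    condition enters only through an inequality free of [s]. *)
Lemma lift_ge w : d (map first_lang w) <= pair_lift d c w.
Proof.
elim/last_ind: w => // w a IH; rewrite lift_rcons map_rcons.
have := d_super (map first_lang w); have := d_ge0 (rcons (map first_lang w) true).
have := d_ge0 (rcons (map first_lang w) false).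
case: a => [[]|] //= ? ? ?; rewrite /first_lang /= ?le_max; last by lra.
by apply/orP; right; lra.
Qed.

(** The values at 1 and -1 have equal weight and the query cancels in their sum 3/2 D(w); what
    remains is 3/2 times the sum in [tE], which is 1. *)
Lemma lift_gale t : (3 / 8) `^ t + (1 / 4) `^ t = 2 / 3 ->
  gale (gamma0 R) t (pair_lift d c).
Proof.
move=> tE; split=> [w|w]; first exact: le_trans (lift_ge w).
rewrite (bigD1 None) // (bigD1 (Some true)) // (bigD1 (Some false)) //=.
rewrite big1 ?addr0; last by case=> [[]|].
rewrite !lift_rcons /=.
have := lift_ge w; have := d_super (map first_lang w).
have := d_ge0 (rcons (map first_lang w) false).
set v := rcons _ true => ? ? ?.
(* For the exact [d], domination and [d_super] make the difference at least d(v0), hence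
   nonnegative. *)
have -> : Num.max 0 (3 / 2 * pair_lift d c w - d v) = 3 / 2 * pair_lift d c w - d v.
  by apply/max_idPr; lra.
have -> : (3 / 8) `^ t = 2 / 3 - (1 / 4) `^ t :> R by rewrite -tE addrK.
by move: (_ `^ _) (pair_lift _ _ _) (d v) => x y z; nra.
Qed.

End Lower.

Lemma qp_computable_lift (d : seq bool -> R) (m : nat) : (forall v, 0 <= d v) ->
  qp_computable d -> qp_computable (pair_lift d (2 ^ m)%:R).
Proof.
move=> d0 [dhat qp_dhat dhat_d].
exists (fun x : seq trit * nat => pair_lift
  (fun v => Num.max 0 (dhat (v, size (enc_unary x)))) (2 ^ m)%:R x.1).
  exact: qp_lift.
move=> w r; rewrite ratr_lift ratr_nat /=.
have -> : size (enc_unary (w, r)) = (size w + r)%N.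
  by rewrite /enc_unary size_cat size_map size_nseq.
have e0 n : 0 <= 2^-1 ^+ n :> R by rewrite exprn_ge0 // invr_ge0.
apply: le_trans (lift_error _ _ (e0 (size w + r)%N) _) _.
  (* Cutting an approximation at 0 only brings it closer to the nonnegative [d v]. *)
  move=> v /=; apply: le_trans (dhat_d v _); have := d0 v.
  rewrite ratr_max rmorph0; move: (ratr _) (d v) => x y y0.
  case: (leP 0 x) => // x0.
  by rewrite sub0r normrN (ger0_norm y0) ler0_norm; lra.
(* Precision |w| + r compensates the factor 2^|w| - 1 of the error bound and leaves 2^-r. *)
rewrite exprD [2^-1 ^+ size w * _]mulrC -mulrA -[leRHS]mulr1.
apply: ler_wpM2l => //.
by rewrite mulrBr mulr1 -exprMn mulVf // expr1n gerBl.
Qed.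

Lemma dim_disjEXP_lt1 (s : R) (d : seq bool -> R) : 0 <= s -> s < 1 / 2 ->
  gale (uniform_bool R) s d -> qp_computable d ->
  (forall A, NP A -> EXP A -> succeeds d (char_seq A)) ->
  (dim_disjEXP R disjNP < 1)%E.
Proof.
move=> s0 s1 [d_ge0 galeE] qp_d win.
have [t /andP[t0 t1] tE] := exists_dimension.
have [m dm] : exists m, d [::] <= (2 ^ m)%:R.
  exists (Num.bound (d [::])); apply: le_trans (ltW (archi_boundP (d_ge0 _))) _.
  by rewrite ler_nat; apply: ltnW; apply: ltn_expl.
(* At s = 1/2 the power is the square root of 1/2, and 2/3 is the square root of 4/9; smaller
   exponents increase it. *)
have z_ge : 2 / 3 <= 2^-1 `^ s :> R.
  apply: (@le_trans _ _ (2^-1 `^ (1 / 2))).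
    rewrite div1r powR12_sqrt ?invr_ge0 // -[leLHS]ger0_norm -?sqrtr_sqr; last by lra.
    by rewrite ler_wsqrtr //; lra.
  by apply: ger_powR; [apply/andP; split; lra | lra].
have d_super v : 2 / 3 * (d (rcons v true) + d (rcons v false)) <= d v.
  rewrite [leRHS]galeE big_bool /= -mulrDl mulrC.
  by apply: ler_wpM2l => //; rewrite addr_ge0.
have t_in : [set s%:E | s in [set s : R | 0 <= s /\ exists d,
    [/\ gale (gamma0 R) s d, qp_computable d &
      forall x, (pair_seq @` (disjNP `&` disjEXP))%classic x -> succeeds d x]]]%classic t%:E.
  exists t => //; split=> //; exists (pair_lift d (2 ^ m)%:R); split.
  - exact: lift_gale.
  - exact: qp_computable_lift.
  move=> _ [[A B] [[_ NPA _] [_ EXPA _]] <-].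
  apply: limn_esup_le_pinfty (win A NPA EXPA) => n; rewrite lee_fin.
  (* Projecting the coded pair recovers the code of [A], on which [d] succeeds; domination passes
     success to the lift. *)
  have -> : mkseq (char_seq A) n = map first_lang (mkseq (pair_seq (A, B)) n).
    rewrite /mkseq -map_comp; apply: eq_map => i; rewrite /char_seq /first_lang /pair_seq /=.
    by case: (A _) => //; case: (B _).
  exact: lift_ge.
by apply: le_lt_trans (ereal_inf_lbound t_in) _; rewrite lte_fin.
Qed.

End Gales.

Theorem theorem6p2 (R : realType) :
  dim_disjEXP R disjNP = 1%E -> (0 < dim_EXP R NP)%E.
Proof.
move=> dim1; rewrite ltNge; apply/negP => dim0.
(* A dimension at most 0 lies below 1/2, so the infimum supplies an exponent for which [2^s] is
   still at most 3/2. *)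
have /ereal_inf_lt[_ [s [s0 [d [gale_d qp_d win]]] <-]] :
    (dim_EXP R NP < (1 / 2)%R%:E)%E.
  by apply: le_lt_trans dim0 _; rewrite lte_fin; lra.
rewrite lte_fin => s1.
have := dim_disjEXP_lt1 s0 s1 gale_d qp_d _.
rewrite dim1 ltxx => /(_ _)/negP; apply => // A NPA EXPA.
by apply: win; exists A.
Qed.
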